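(* Let $n\ge1$ and consider $\Omega_n$ (a poset of rank $n$) with the natural action of $\mathfrak S_n$. Then: (a) For $0\le k\le n-1$, $\operatorname{ch}WH^*_k(\Omega_n)=\sum_{\alpha\in\mathcal C(n,k+1)}h_\alpha$, and $\operatorname{ch}WH^*_n(\Omega_n)=e_n$. In particular the dual Whitney homology is a permutation module in all but the top dimension. (b) For $0\le k\le n-1$, $\operatorname{ch}WH_{n-k}(\Omega_n)=\sum_{\alpha\in\mathcal C(n,k+1)}e_\alpha$, and $\operatorname{ch}WH_0(\Omega_n)=h_n$. (c) As $\mathfrak S_n$-modules, $WH_{n-k}(\Omega_n)=\operatorname{sgn}_n\otimes WH^*_k(\Omega_n)$, where $\operatorname{sgn}_n$ is the sign representation.
   Context: An ordered set partition of $[n]=\{1,\ldots,n\}$ is a sequence $(B_1,\ldots,B_k)$ of nonempty disjoint blocks with union $[n]$. These are ordered by letting $(B_1,\ldots,B_k)$ be covered by each $(B_1,\ldots,B_i\cup B_{i+1},\ldots,B_k)$ (merging two adjacent blocks in place), extended transitively; $\Omega_n$ is this poset with a minimum $\hat0$ adjoined; its maximum is $\hat1=([n])$. $\mathfrak S_n$ acts by permuting entries of blocks. Homology is reduced simplicial homology over $\mathbb Q$ of order complexes of open intervals. Whitney homology $WH_i(P)=\bigoplus_{\operatorname{rk}x=i}\tilde H_{i-2}(\hat0,x)$ and dual Whitney homology $WH^*_i(P)=\bigoplus_{\operatorname{crk}x=i}\tilde H_{i-2}(x,\hat1)$ (with $WH_0,WH^*_0$ trivial), as $\mathfrak S_n$-modules;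 $\operatorname{ch}$ is the Frobenius characteristic. $\mathcal C(n,k)$ is the set of compositions of $n$ with $k$ parts; $h_\alpha=\prod h_{\alpha_i}$, $e_\alpha=\prod e_{\alpha_i}$ (complete homogeneous and elementary symmetric functions). *)

(* Defs.v *)
From HB Require Import structures.
From mathcomp Require Import all_boot all_order all_fingroup all_algebra.
From mathcomp Require Import mxrepresentation character.
From mathcomp Require Import mpoly.

Set Implicit Arguments.
Unset Strict Implicit.
Unset Printing Implicit Defensive.

Import Order.TTheory GRing.Theory GroupScope.
Local Open Scope ring_scope.

(* Modules over a finite group are representations by rational matrices       *)
(* acting on row vectors from the right.  In the permutation group 'S_n,      *)
(* (s * t) i = t (s i), so right modules for that product are left modules    *)
(* for the usual composition of permutations.                                 *)

Section PermutationModules.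

Variables (gT : finGroupType) (X : finType) (to : {action gT &-> X}).

Definition basis_vec (x : X) : 'rV[rat]_#|X| := delta_mx 0 (enum_rank x).

Definition perm_module_mx (a : gT) : 'M[rat]_#|X| :=
  \matrix_(i < #|X|) basis_vec (to (enum_val i) a).

Lemma basis_vec_act x a : basis_vec x *m perm_module_mx a = basis_vec (to x a).
Proof. by rewrite -rowE rowK enum_rankK. Qed.

Lemma perm_module_mxP : mx_repr [set: gT] perm_module_mx.
Proof.
split=> [|a b _ _]; apply/row_matrixP=> i.
  by rewrite rowK act1 row1 /basis_vec enum_valK.
by rewrite row_mul !rowK basis_vec_act actM.
Qed.

Definition perm_module : mx_representation rat [set: gT] #|X| :=
  MxRepresentation perm_module_mxP.

End PermutationModules.

Definition is_perm_module (gT : finGroupType) (m : nat)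
    (V : mx_representation rat [set: gT] m) : Prop :=
  exists (X : finType) (to : {action gT &-> X}), mx_rsim V (perm_module to).

Section PosetHomology.

Variables (d : Order.disp_t) (P : finPOrderType d).

Definition is_chain (c : {set P}) : bool :=
  [forall u in c, forall v in c, (u >=< v)%O].

Definition open_interval (x y : P) : {set P} := [set z | (x < z < y)%O].

(* The faces of dimension j of the order complex of (x, y).  The empty chain  *)
(* is the face of dimension -1, so the homology below is reduced.             *)
Definition is_face (x y : P) (j : int) (c : {set P}) : bool :=
  [&& is_chain c, c \subset open_interval x y & #|c|%:Z == j + 1].

(* All chain groups live in the space with basis the set of all subsets of P. *)
Local Notation N := #|{: {set P}}|.

Definition boundary_of (c : {set P}) : 'rV[rat]_N :=
  \sum_(z in c) (-1) ^+ #|[set u in c | (u < z)%O]| *: basis_vec (c :\ z).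

Definition boundary : 'M[rat]_N := \matrix_(i < N) boundary_of (enum_val i).

Definition chain_space (x y : P) (j : int) : 'M[rat]_N :=
  (\sum_(c | is_face x y j c) <<basis_vec c>>)%MS.

Definition cycle_space (x y : P) (j : int) : 'M[rat]_N :=
  (chain_space x y j :&: kermx boundary)%MS.

Definition bound_space (x y : P) (j : int) : 'M[rat]_N :=
  chain_space x y (j + 1) *m boundary.

(* \tilde H_j (x, y) = Z_j / B_j: the row space of homology_space, made of    *)
(* the classes of cycles in the quotient of the ambient space by B_j.         *)
Definition homology_space (x y : P) (j : int) :=
  <<in_factmod (bound_space x y j) (cycle_space x y j)>>%MS.

Definition homology_dim (x y : P) (j : int) : nat :=
  \rank (homology_space x y j).

(* Representative cycles of a basis of \tilde H_j(x, y).                      *)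
Definition homology_lift (x y : P) (j : int) :
    'M[rat]_(homology_dim x y j, N) :=
  @val_factmod _ _ (bound_space x y j) _
    (@val_submod _ _ (homology_space x y j) _ 1%:M).

(* Coordinates of the classes of cycles in that basis.                        *)
Definition homology_class (x y : P) (j : int) :
    'M[rat]_(N, homology_dim x y j) :=
  in_submod (homology_space x y j) (in_factmod (bound_space x y j) (1%:M : 'M_N)).

Definition homology_sum_dim (T : {set P * P}) (j : int) : nat :=
  \sum_(s < #|T|) homology_dim (enum_val s).1 (enum_val s).2 j.

End PosetHomology.

Section IntervalSums.

Variables (d : Order.disp_t) (P : finPOrderType d).
Variables (gT : finGroupType) (to : {action gT &-> P}).
Hypothesis to_mono : forall a, {mono to^~ a : x y / (x <= y)%O}.

Local Notation A := (perm_module (to^*)%act).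

Lemma to_mono_lt a : {mono to^~ a : x y / (x < y)%O}.
Proof. exact: leW_mono (to_mono a). Qed.

Lemma is_chain_act (c : {set P}) a : is_chain c -> is_chain (to^*%act c a).
Proof.
move=> /'forall_in_forall_inP ch; apply/'forall_in_forall_inP=> _ /imsetP[u uc ->].
by move=> _ /imsetP[v vc ->]; rewrite /Order.comparable !to_mono; apply: ch.
Qed.

Lemma is_face_act x y j c a :
  is_face x y j c -> is_face (to x a) (to y a) j (to^*%act c a).
Proof.
case/and3P=> ch /subsetP sub cj; rewrite /is_face is_chain_act //=.
rewrite card_imset ?cj ?andbT; last exact: act_inj.
by apply/subsetP=> _ /imsetP[u /sub uc ->]; move: uc; rewrite !inE !to_mono_lt.
Qed.

Lemma boundary_act a : A a *m boundary P = boundary P *m A a.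
Proof.
apply/row_matrixP=> i; rewrite !row_mul !rowK -rowE rowK enum_rankK.
rewrite /boundary_of mulmx_suml big_imset /=; last first.
  by move=> u v _ _; apply: act_inj.
apply: eq_bigr=> z _; rewrite -scalemxAl basis_vec_act.
congr (_ ^+ _ *: basis_vec _).
  rewrite -[RHS](card_imset _ (act_inj to a)); apply: eq_card=> v.
  rewrite inE; apply/andP/imsetP.
    by case=> /imsetP[u uc ->]; rewrite to_mono_lt => uz; exists u; rewrite ?inE ?uc.
  by case=> u /setIdP[uc uz] ->; rewrite to_mono_lt uz (imset_f (to^~ a) uc).
apply/setP=> v; apply/setD1P/imsetP.
  case=> vz /imsetP[u uc ev]; exists u; rewrite // !inE uc andbT.
  by apply: contraNneq vz => <-; rewrite ev.
case=> u /setD1P[uz uc] ->; split; last exact: imset_f.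
by rewrite (inj_eq (act_inj to a)).
Qed.

Lemma chain_space_act x y j a :
  (chain_space x y j *m A a <= chain_space (to x a) (to y a) j)%MS.
Proof.
rewrite sumsmxMr_gen; apply/sumsmx_subP=> c fc.
rewrite genmxE (eqmxMr _ (genmxE _)) basis_vec_act.
by apply: (sumsmx_sup (to^*%act c a)); rewrite ?is_face_act ?genmxE.
Qed.

Lemma bound_space_act x y j a :
  (bound_space x y j *m A a <= bound_space (to x a) (to y a) j)%MS.
Proof. by rewrite -mulmxA -boundary_act mulmxA submxMr ?chain_space_act. Qed.

Lemma cycle_space_act x y j a :
  (cycle_space x y j *m A a <= cycle_space (to x a) (to y a) j)%MS.
Proof.
rewrite (submx_trans (capmxMr _ _ _)) // capmxS ?chain_space_act //.
by apply/sub_kermxP; rewrite -mulmxA boundary_act mulmxA mulmx_ker mul0mx.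
Qed.

Section Classes.

Variables (x y : P) (j : int).
Local Notation B := (bound_space x y j).
Local Notation Z := (cycle_space x y j).

Lemma homology_liftP : (homology_lift x y j <= B + Z)%MS.
Proof.
rewrite /homology_lift.
have : (@val_submod _ _ (homology_space x y j) _ 1%:M <= in_factmod B Z)%MS.
  by rewrite -(genmxE (in_factmod B Z)) val_submodP.
case/submxP=> w ->.
have -> : w *m in_factmod B Z = in_factmod B (w *m Z) by rewrite /in_factmod /= mulmxA.
by apply: submx_trans (proj_factmodS _ _) _; rewrite addsmxS ?submxMl.
Qed.

Lemma homology_classE m (W : 'M_(m, _)) :
  W *m homology_class x y j = in_submod (homology_space x y j) (in_factmod B W).
Proof. by rewrite /homology_class /in_submod /in_factmod /= !mulmxA mulmx1. Qed.

Lemma homology_class_bound m (W : 'M_(m, _)) :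
  (W <= B)%MS -> W *m homology_class x y j = 0.
Proof.
by rewrite -in_factmod_eq0 homology_classE => /eqP->; rewrite linear0.
Qed.

Lemma homology_liftK : homology_lift x y j *m homology_class x y j = 1%:M.
Proof. by rewrite homology_classE val_factmodK val_submodK. Qed.

Lemma homology_classK m (W : 'M_(m, _)) : (W <= B + Z)%MS ->
  (W *m homology_class x y j *m homology_lift x y j - W <= B)%MS.
Proof.
move=> WBZ; rewrite homology_classE /homology_lift.
rewrite val_factmodE [_ *m (_ *m _)]mulmxA -val_submodE in_submodK -?val_factmodE.
  rewrite -{2}[W](add_sub_fact_mod B) opprD addrCA subrr addr0.
  by rewrite eqmx_opp val_submodP.
rewrite genmxE -(in_factmod_addsK B Z).
by rewrite /in_factmod /= submxMr.
Qed.

End Classes.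

(* The map \tilde H_j(p) -> \tilde H_j(q) induced by a when q = p a.          *)
Definition induced_mx (j : int) (a : gT) (p q : P * P) :
    'M[rat]_(homology_dim p.1 p.2 j, homology_dim q.1 q.2 j) :=
  if (to p.1 a, to p.2 a) == q
  then homology_lift p.1 p.2 j *m A a *m homology_class q.1 q.2 j else 0.

Lemma induced_mx1 j p : induced_mx j 1%g p p = 1%:M.
Proof.
by rewrite /induced_mx !act1 -surjective_pairing eqxx repr_mx1 mulmx1 homology_liftK.
Qed.

Lemma induced_mxM j a b p q r : (to p.1 a, to p.2 a) = q ->
  induced_mx j a p q *m induced_mx j b q r = induced_mx j (a * b)%g p r.
Proof.
move=> <-{q}; rewrite /induced_mx eqxx /= !actM.
case: eqP => [<-{r} /=|_]; last by rewrite mulmx0.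
rewrite (perm_module_mxP (to^*)%act).2 ?inE //.
rewrite 2!(mulmxA (_ *m homology_class _ _ _)).
rewrite [in RHS](mulmxA (homology_lift _ _ _)).
apply/eqP; rewrite -subr_eq0 -!mulmxBl; apply/eqP/homology_class_bound.
apply: submx_trans (bound_space_act _ _ _ _); rewrite submxMr //.
apply: homology_classK.
rewrite (submx_trans (submxMr _ (homology_liftP _ _ _))) //.
by rewrite addsmxMr addsmxS ?bound_space_act ?cycle_space_act.
Qed.

Variables (T : {set P * P}) (j : int).
Hypothesis T_act : forall a p, p \in T -> (to p.1 a, to p.2 a) \in T.

(* The direct sum of the \tilde H_j(x, y) for (x, y) in T, where a maps the    *)
(* summand (x, y) to the summand (x a, y a).                                  *)
Definition homology_sum_mx (a : gT) : 'M[rat]_(homology_sum_dim T j) :=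
  \mxblock_(s < #|T|, t < #|T|) induced_mx j a (enum_val s) (enum_val t).

Lemma homology_sum_mxP : mx_repr [set: gT] homology_sum_mx.
Proof.
split=> [|a b _ _].
  rewrite -mxdiagZ; apply/eq_mxblock=> s t; case: eqVneq => [<-|st].
    by rewrite conform_mx_id induced_mx1.
  rewrite /induced_mx !act1 -surjective_pairing ifN //.
  by rewrite (inj_eq enum_val_inj).
rewrite /homology_sum_mx mul_mxblock; apply/eq_mxblock=> s t.
have pT := T_act a (enum_valP s).
rewrite (bigD1 (enum_rank_in pT (to (enum_val s).1 a, to (enum_val s).2 a))) //=.
rewrite big1 ?addr0 => [|u us]; first by rewrite induced_mxM // enum_rankK_in.
rewrite /induced_mx ifN ?mul0mx //; apply: contraNneq us => eu.
by rewrite -(inj_eq enum_val_inj) enum_rankK_in // eu.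
Qed.

Definition homology_sum :
    mx_representation rat [set: gT] (homology_sum_dim T j) :=
  MxRepresentation homology_sum_mxP.

End IntervalSums.

Section GroupModules.

Variable gT : finGroupType.

Lemma triv_moduleP : mx_repr [set: gT] (fun _ : gT => 1%:M : 'M[rat]_1).
Proof. by split=> [|a b _ _]; rewrite ?mulmx1. Qed.

Definition triv_module : mx_representation rat [set: gT] 1 :=
  MxRepresentation triv_moduleP.

End GroupModules.

Section Whitney.

Variables (d : Order.disp_t) (P : finTBPOrderType d).

(* For x = \top this is the rank of P. *)
Definition rk (x : P) : nat :=
  \max_(c : {set P} | is_chain c && [forall z in c, (z <= x)%O]) #|c|.-1.

Definition crk (x : P) : nat := rk \top%O - rk x.

Definition graded_of_rank (r : nat) : Prop :=
  forall c : {set P}, maxset (@is_chain d P) c -> #|c| = r.+1.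

Variables (gT : finGroupType) (to : {action gT &-> P}).
Hypothesis to_mono : forall a, {mono to^~ a : x y / (x <= y)%O}.

Lemma bot_act a : to \bot%O a = \bot%O.
Proof.
apply: le_anti; rewrite le0x andbT.
have : (to \bot%O a <= to (to \bot%O a^-1%g) a)%O by rewrite to_mono le0x.
by rewrite actKV.
Qed.

Lemma top_act a : to \top%O a = \top%O.
Proof.
apply: le_anti; rewrite lex1 /=.
have : (to (to \top%O a^-1%g) a <= to \top%O a)%O by rewrite to_mono lex1.
by rewrite actKV.
Qed.

Lemma rk_act x a : rk (to x a) = rk x.
Proof.
have le_rk y b : (rk y <= rk (to y b))%N.
  apply/bigmax_leqP=> c /andP[ch /forall_inP cy].
  rewrite -(card_imset _ (act_inj to b)).
  apply: (@leq_bigmax_cond _ _ (fun c : {set P} => #|c|.-1)).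
  rewrite (is_chain_act to_mono) //=; apply/forall_inP=> _ /imsetP[z zc ->].
  by rewrite to_mono cy.
apply/eqP; rewrite eqn_leq le_rk andbT.
by rewrite -{2}[x](actK to a) le_rk.
Qed.

Definition lower_intervals (i : nat) : {set P * P} :=
  [set p | (p.1 == \bot%O) && (rk p.2 == i)].

Definition upper_intervals (i : nat) : {set P * P} :=
  [set p | (p.2 == \top%O) && (crk p.1 == i)].

Lemma lower_intervals_act i a p :
  p \in lower_intervals i -> (to p.1 a, to p.2 a) \in lower_intervals i.
Proof. by rewrite !inE /= rk_act => /andP[/eqP-> ->]; rewrite bot_act eqxx. Qed.

Lemma upper_intervals_act i a p :
  p \in upper_intervals i -> (to p.1 a, to p.2 a) \in upper_intervals i.
Proof. by rewrite !inE /= /crk rk_act => /andP[/eqP-> ->]; rewrite top_act eqxx. Qed.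

Definition WH_dim (i : nat) : nat :=
  if i is 0 then 1 else homology_sum_dim (lower_intervals i) (i%:Z - 2).

Definition WH (i : nat) : mx_representation rat [set: gT] (WH_dim i) :=
  match i return mx_representation rat [set: gT] (WH_dim i) with
  | 0 => triv_module gT
  | i'.+1 => homology_sum to_mono (i'.+1%:Z - 2) (@lower_intervals_act i'.+1)
  end.

Definition dualWH_dim (i : nat) : nat :=
  if i is 0 then 1 else homology_sum_dim (upper_intervals i) (i%:Z - 2).

Definition dualWH (i : nat) : mx_representation rat [set: gT] (dualWH_dim i) :=
  match i return mx_representation rat [set: gT] (dualWH_dim i) with
  | 0 => triv_module gT
  | i'.+1 => homology_sum to_mono (i'.+1%:Z - 2) (@upper_intervals_act i'.+1)
  end.

End Whitney.

Section OrderedSetPartitions.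

Variable n : nat.

Definition is_osp (s : seq {set 'I_n}) : bool :=
  [&& set0 \notin s, pairwise (fun A B : {set 'I_n} => [disjoint A & B]) s
    & \bigcup_(B <- s) B == setT].

Record osp : predArgType := OSP { blocks :> seq {set 'I_n}; _ : is_osp blocks }.

HB.instance Definition _ := [isSub for blocks].
HB.instance Definition _ := [Countable of osp by <:].

Lemma osp_size (x : osp) : (size x <= n)%N.
Proof.
case: x => s /= /and3P[s0 sd /eqP sT].
rewrite -[X in (_ <= X)%N]card_ord -cardsT -sT {sT}.
elim: s s0 sd => [|B s IHs]; rewrite ?inE ?negb_or //=.
case/andP=> B0 s0 /andP[/allP Bs sd].
rewrite big_cons cardsU (_ : B :&: _ = set0) ?cards0 ?subn0.
  by rewrite -add1n leq_add ?IHs // card_gt0 eq_sym.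
apply/setP=> i; rewrite !inE bigcup_seq; apply/andP=> -[iB /bigcupP[C Cs iC]].
by have /pred0P/(_ i) := Bs C Cs; rewrite /= iB iC.
Qed.

Definition osp_code (x : osp) : n.-bseq {set 'I_n} := Bseq (osp_size x).
Definition osp_decode (s : n.-bseq {set 'I_n}) : option osp := insub (val s).
Lemma osp_codeK : pcancel osp_code osp_decode.
Proof. exact: valK. Qed.

HB.instance Definition _ : isFinite osp := PCanIsFinite osp_codeK.

(* Merges the i-th and (i + 1)-st blocks, counted from 0.                    *)
Definition merge_blocks (i : nat) (s : seq {set 'I_n}) : seq {set 'I_n} :=
  take i s ++ (nth set0 s i :|: nth set0 s i.+1) :: drop i.+2 s.

Definition merges_to (x y : osp) : bool :=
  [exists i : 'I_(size x).-1, blocks y == merge_blocks i x].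

Definition osp_le : rel osp := connect merges_to.

Lemma merge_cat (s1 s2 : seq {set 'I_n}) A B :
  merge_blocks (size s1) (s1 ++ A :: B :: s2) = s1 ++ (A :|: B) :: s2.
Proof.
rewrite /merge_blocks take_size_cat // !nth_cat ltnn subnn ltnNge leqnSn /= subSnn.
by rewrite drop_cat ltnNge -addn2 leq_addr /= addKn /= drop0.
Qed.

Lemma mergeE (s : seq {set 'I_n}) i : (i.+1 < size s)%N ->
  exists s1 A B s2,
    [/\ s = s1 ++ A :: B :: s2 & merge_blocks i s = s1 ++ (A :|: B) :: s2].
Proof.
move=> si; exists (take i s), (nth set0 s i), (nth set0 s i.+1), (drop i.+2 s).
by split; rewrite // -!drop_nth ?cat_take_drop // ltnW.
Qed.

Lemma merge_osp (s : seq {set 'I_n}) i :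
  is_osp s -> (i.+1 < size s)%N -> is_osp (merge_blocks i s).
Proof.
move=> os /mergeE[s1 [A [B [s2 [es ->]]]]]; move: os; rewrite {}es.
have disjU (C D E : {set 'I_n}) :
    [disjoint C & D :|: E] = [disjoint C & D] && [disjoint C & E].
  by rewrite -!setI_eq0 setIUr setU_eq0.
case/and3P=> s0 sd sT; apply/and3P; split.
- move: s0; rewrite !mem_cat !inE !negb_or => /and4P[-> A0 _ ->].
  by rewrite andbT /= eq_sym setU_eq0 negb_and eq_sym A0.
- move: sd; rewrite !pairwise_cat !allrel_consr /=.
  case/and3P=> /and3P[s1A s1B ->] -> /and3P[/andP[_ As2] Bs2 ->] /=.
  rewrite !andbT; apply/andP; split; apply/allP=> C Cs.
    by rewrite disjU (allP s1A) ?(allP s1B).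
  by rewrite disjoint_sym disjU !(disjoint_sym C) (allP As2) ?(allP Bs2).
- by move: sT; rewrite !big_cat !big_cons /= !setUA.
Qed.

Lemma merge_size (s : seq {set 'I_n}) i :
  (i.+1 < size s)%N -> size (merge_blocks i s) = (size s).-1.
Proof.
by move/mergeE=> [s1 [A [B [s2 [-> ->]]]]]; rewrite !size_cat /= !addnS.
Qed.

Lemma merges_toP (x y : osp) :
  reflect (exists2 i, (i.+1 < size x)%N & blocks y = merge_blocks i x) (merges_to x y).
Proof.
apply: (iffP existsP) => [[i /eqP ->]|[i ix ->]].
  by exists i => //; rewrite -ltn_predRL.
have ix' : (i < (size x).-1)%N by case: (size x) ix.
by exists (Ordinal ix').
Qed.

Lemma merges_to_size x y : merges_to x y -> (size y < size x)%N.
Proof.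
case/merges_toP=> i ix ->; rewrite merge_size // prednK //; exact: ltn_trans ix.
Qed.

Lemma osp_le_size x y : osp_le x y -> x = y \/ (size y < size x)%N.
Proof.
case/connectP=> p; elim: p x => [|z p IHp] x /=; first by left.
case/andP=> /merges_to_size xz /IHp{}IHp /IHp[<-|yz]; right=> //.
exact: ltn_trans xz.
Qed.

Lemma osp_le_anti : antisymmetric osp_le.
Proof.
move=> x y /andP[/osp_le_size[//|xy] /osp_le_size[//|yx]].
by have := ltn_trans xy yx; rewrite ltnn.
Qed.

(* This is ([n]) if n > 0, and the empty sequence if n = 0.                   *)
Definition osp_top_blocks : seq {set 'I_n} := [seq B <- [:: setT] | B != set0].

Lemma osp_topP : is_osp osp_top_blocks.
Proof.
rewrite /is_osp /osp_top_blocks /=; case: eqVneq => [e|T0].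
  by rewrite big_nil -e eqxx.
by rewrite inE eq_sym T0 /= big_seq1 eqxx.
Qed.

Definition osp_top : osp := OSP osp_topP.

Lemma osp_le_top x : osp_le x osp_top.
Proof.
have [m] := ubnP (size x); elim: m x => // m IHm x xm.
have [x1|x1] := ltnP 1 (size x).
  pose y : osp := OSP (merge_osp (valP x) x1).
  have xy : merges_to x y by apply/merges_toP; exists 0%N.
  apply: connect_trans (connect1 xy) (IHm _ _).
  exact: leq_trans (merges_to_size xy) xm.
suff -> : x = osp_top by apply: connect0.
apply: val_inj; case: x x1 {xm} => -[|B [|//]] /= /and3P[s0 _ /eqP sT] _.
  by rewrite /osp_top_blocks /= -sT big_nil eqxx.
by move: s0 sT; rewrite big_seq1 inE eq_sym /osp_top_blocks /= => + <- => ->.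
Qed.

Definition osp_act_blocks (s : seq {set 'I_n}) (a : 'S_n) : seq {set 'I_n} :=
  [seq [set a i | i in B] | B : {set 'I_n} <- s].

Lemma osp_act_is_osp (x : osp) a : is_osp (osp_act_blocks x a).
Proof.
case: x => s /= /and3P[s0 sd /eqP sT]; apply/and3P; split.
- by apply: contra s0 => /mapP[B Bs /esym/eqP]; rewrite imset_eq0 => /eqP<-.
- rewrite pairwise_map; apply: sub_pairwise sd => A B /=.
  by rewrite -!setI_eq0 -imsetI ?imset_eq0 //; move=> ? ? _ _; apply: perm_inj.
- apply/eqP/setP=> i; rewrite inE big_map bigcup_seq.
  have : a^-1%g i \in [set: 'I_n] by [].
  rewrite -sT bigcup_seq => /bigcupP[B Bs iB]; apply/bigcupP; exists B => //.
  by apply/imsetP; exists (a^-1%g i); rewrite ?permKV.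
Qed.

Definition osp_act (x : osp) (a : 'S_n) : osp := OSP (osp_act_is_osp x a).

Lemma osp_act1 x : osp_act x 1%g = x.
Proof.
apply: val_inj => /=; rewrite -[RHS]map_id; apply: eq_map => B.
by rewrite -[RHS]imset_id; apply: eq_imset => i; rewrite perm1.
Qed.

Lemma osp_actM x a b : osp_act x (a * b)%g = osp_act (osp_act x a) b.
Proof.
apply: val_inj => /=; rewrite /osp_act_blocks -map_comp; apply: eq_map => B /=.
by rewrite -imset_comp; apply: eq_imset => i; rewrite permM.
Qed.

Lemma osp_act_merge s i a : (i.+1 < size s)%N ->
  osp_act_blocks (merge_blocks i s) a = merge_blocks i (osp_act_blocks s a).
Proof.
move=> si; rewrite /osp_act_blocks /merge_blocks map_cat map_take /= map_drop.
by rewrite !(nth_map set0) // ?imsetU // ltnW.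
Qed.

Lemma osp_act_le x y a : osp_le x y -> osp_le (osp_act x a) (osp_act y a).
Proof.
case/connectP=> p; elim: p x => [|z p IHp] x /=; first by move=> _ ->; apply: connect0.
case/andP=> /merges_toP[i ix zE] /IHp{}IHp /IHp; apply: connect_trans.
apply: connect1; apply/merges_toP; exists i; first by rewrite size_map.
by rewrite /= zE osp_act_merge.
Qed.

Lemma osp_act_mono a : {mono osp_act^~ a : x y / osp_le x y}.
Proof.
move=> x y; apply/idP/idP; last exact: osp_act_le.
by move/(osp_act_le a^-1%g); rewrite -!osp_actM mulgV !osp_act1.
Qed.

End OrderedSetPartitions.

(* Some x is an ordered set partition, None is the adjoined minimum.          *)
Definition Omega (n : nat) : predArgType := option (osp n).

HB.instance Definition _ n := Finite.on (Omega n).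

Fact omega_display : Order.disp_t. Proof. exact: Order.Disp tt tt. Qed.

Section OmegaPoset.

Variable n : nat.

Definition omega_le (x y : Omega n) : bool :=
  match x, y with
  | None, _ => true
  | Some _, None => false
  | Some u, Some v => osp_le u v
  end.

Lemma omega_le_refl : reflexive omega_le.
Proof. by case=> // x; apply: connect0. Qed.

Lemma omega_le_anti : antisymmetric omega_le.
Proof. by case=> [x|] [y|] // /osp_le_anti->. Qed.

Lemma omega_le_trans : transitive omega_le.
Proof. by case=> [y|] [x|] [z|] //; apply: connect_trans. Qed.

HB.instance Definition _ := Order.Le_isPOrder.Build omega_display (Omega n)
  omega_le_refl omega_le_anti omega_le_trans.

Lemma omega_le0 (x : Omega n) : (None <= x :> Omega n)%O.
Proof. by []. Qed.

Lemma omega_le1 (x : Omega n) : (x <= Some (osp_top n) :> Omega n)%O.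
Proof. by case: x => // x; apply: osp_le_top. Qed.

HB.instance Definition _ :=
  Order.hasBottom.Build omega_display (Omega n) omega_le0.
HB.instance Definition _ :=
  Order.hasTop.Build omega_display (Omega n) omega_le1.

Definition omega_act_fun (x : Omega n) (a : 'S_n) : Omega n :=
  omap (fun u => osp_act u a) x.

Lemma omega_act1 : omega_act_fun^~ 1%g =1 id.
Proof. by case=> //= x; rewrite osp_act1. Qed.

Lemma omega_actM : forall x, act_morph omega_act_fun x.
Proof. by case=> // x a b; rewrite /omega_act_fun /= osp_actM. Qed.

Definition omega_act : {action 'S_n &-> Omega n} :=
  TotalAction omega_act1 omega_actM.

Lemma omega_act_mono a : {mono omega_act^~ a : x y / (x <= y)%O}.
Proof. by case=> [x|] [y|] //; apply: osp_act_mono. Qed.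

Definition WH_Omega (i : nat) := WH omega_act_mono i.
Definition dualWH_Omega (i : nat) := dualWH omega_act_mono i.

End OmegaPoset.

(* A symmetric function is determined by its restrictions to finitely many    *)
(* variables; N is the number of variables.                                   *)
Section SymmetricFunctions.

Variable N : nat.

Definition e_sym (k : nat) : {mpoly rat[N]} := mesym N rat k.

Definition h_sym (k : nat) : {mpoly rat[N]} :=
  \sum_(m : 'X_{1..N < k.+1} | mdeg m == k) 'X_[m].

Definition p_sym (k : nat) : {mpoly rat[N]} := \sum_(i < N) 'X_i ^+ k.

(* The Frobenius characteristic in N variables: p_w is the product of the     *)
(* power sums indexed by the cycle lengths of w.                              *)
Definition ch (n m : nat) (V : mx_representation rat [set: 'S_n] m) :
    {mpoly rat[N]} :=
  (n`!%:R)^-1 *: \sum_(w : 'S_n) \tr (V w) *: \prod_(C in porbits w) p_sym #|C|.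

End SymmetricFunctions.

(* Parts of a composition of n are at most n.                                 *)
Definition compositions (n k : nat) : {set k.-tuple 'I_n.+1} :=
  [set alpha : k.-tuple 'I_n.+1 |
    [forall i, 0 < tnth alpha i]%N && (\sum_(i < k) tnth alpha i == n)%N].

Definition hcomp (N n k : nat) (alpha : k.-tuple 'I_n.+1) : {mpoly rat[N]} :=
  \prod_(i < k) h_sym N (tnth alpha i).

Definition ecomp (N n k : nat) (alpha : k.-tuple 'I_n.+1) : {mpoly rat[N]} :=
  \prod_(i < k) e_sym N (tnth alpha i).

Section SignModule.

Variable n : nat.

Lemma sgn_moduleP :
  mx_repr [set: 'S_n] (fun w : 'S_n => ((-1) ^+ w)%:M : 'M[rat]_1).
Proof.
split=> [|a b _ _]; first by rewrite odd_perm1.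
by rewrite odd_permM signr_addb scalar_mxM.
Qed.

Definition sgn_module : mx_representation rat [set: 'S_n] 1 :=
  MxRepresentation sgn_moduleP.

End SignModule.

(* Main.v *)
(* Give a graded poset weights lam on its covering pairs which satisfy        *)
(* sum_z lam x z * lam z w = 0 on every interval of length two, and for which *)
(* these relations determine lam x up to a scalar.  Then the top homology of  *)
(* each open interval is a line, spanned by the cycle whose coefficient on a  *)
(* maximal chain is the product of the weights of its covering steps.  On     *)
(* Omega_n, merging the blocks k and k + 1 gets weight (-1)^k and an atom,    *)
(* that is a permutation, gets its sign: all weights are invariant under S_n  *)
(* except those of the atoms, which are multiplied by the sign.  Hence the    *)
(* dual Whitney homology is the permutation module on the ordered set         *)
(* partitions with k + 1 blocks, and the Whitney homology is its sign twist.  *)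
(* Their characteristics follow by counting the orbits of S_n on pairs of an  *)
(* ordered set partition and a coloring of [n].                               *)
Require Import Defs.
From mathcomp Require Import all_boot all_order all_fingroup all_algebra.
From mathcomp Require Import mxrepresentation character mpoly.
From mathcomp Require Import zify ring.

Set Implicit Arguments.
Unset Strict Implicit.
Unset Printing Implicit Defensive.

Import Order.TTheory GRing.Theory GroupScope.
Local Open Scope ring_scope.

(** * Fundamental cycles of graded posets with incidence numbers *)

(** Every Whitney summand lies in the top dimension of its interval, where there are no boundaries.
    Its homology is therefore the space of top cycles: functions on maximal chains whose signed sum
    over the chains through each face of codimension one vanishes. If the weights of covering steps
    satisfy the diamond relation, the products of weights along chains form such a cycle
    ([fcyc_cycle]). If moreover the diamond relations determine the weights of the steps leaving [x]
    up to a scalar, induction on the lowest step makes every top cycle a multiple of that one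
    ([fcyc_uniq]).

    On [Omega n] both conditions are elementary. Two merges can be done in either order, and the two
    orders carry opposite signs. An element of rank two lies above exactly two atoms, which differ
    by an adjacent exchange, and the atoms below a given element are connected by such exchanges
    ([incidence_diamond], [incidence_exact]).

    A permutation carries the cycle of an interval to the cycle of the image interval, with its sign
    as a factor exactly when the lower end is the adjoined minimum. These cycles thus identify each
    Whitney module with some [osp_module n b k]: the permutation module on ordered partitions with
    [k] blocks, twisted by the sign when [b] holds. The same blocks occur for $WH_{n-k}$ and
    $WH^*_k$ with opposite [b], and tensoring with the sign flips [b] ([sgn_osp_module]); this gives
    (c).

    For the characteristic, an ordered partition with [k] blocks is a surjection onto [k] labels,
    and the power sum product of [w] enumerates the colorings by variables that [w] fixes. Together
    they are colorings of [n] by pairs (label, variable). The sign sums to zero over the stabilizer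
    of a coloring unless that coloring is injective, and by the orbit-stabilizer theorem each matrix
    of fiber sizes contributes one monomial. The matrices have no zero row, total n, and entries at
    most 1 in the signed case; summing row by row gives products of h or of e ([ch_osp_module]). *)

Section IncidenceSystem.

Variables (d : Order.disp_t) (P : finPOrderType d) (rho : P -> nat).

Definition cov (x z : P) : bool := (x < z)%O && (rho z == (rho x).+1).

Definition interval_chain (x y : P) (c : {set P}) : bool :=
  is_chain c && (c \subset open_interval x y).

Lemma covW x z : cov x z -> (x < z)%O.
Proof. by case/andP. Qed.

Lemma cov_rho x z : cov x z -> rho z = (rho x).+1.
Proof. by case/andP=> _ /eqP. Qed.

Hypothesis rho_lt : forall x y, (x < y)%O -> (rho x < rho y)%N.

Lemma rho_le x y : (x <= y)%O -> (rho x <= rho y)%N.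
Proof. by rewrite le_eqVlt => /predU1P[->|/rho_lt/ltnW]. Qed.

Lemma le_rho_eq x y : (x <= y)%O -> rho x = rho y -> x = y.
Proof. by rewrite le_eqVlt => /predU1P[//|/rho_lt + e]; rewrite e ltnn. Qed.

Lemma is_chainP (c : {set P}) :
  reflect {in c &, forall u v, (u >=< v)%O} (is_chain c).
Proof.
by apply: (iffP 'forall_in_forall_inP) => [h u v uc vc|h u uc v vc]; apply: h.
Qed.

Lemma is_chainS (c c' : {set P}) : c' \subset c -> is_chain c -> is_chain c'.
Proof. by move=> /subsetP s /is_chainP h; apply/is_chainP=> u v /s uc /s; apply: h. Qed.

Lemma is_chain_setU1 z (c : {set P}) :
  {in c, forall u, (z >=< u)%O} -> is_chain c -> is_chain (z |: c).
Proof.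
move=> h /is_chainP cc; apply/is_chainP=> u v /setU1P[->|uc] /setU1P[->|vc].
- exact: comparablexx.
- exact: h.
- by rewrite comparable_sym; apply: h.
- exact: cc.
Qed.

Lemma chain_min (c : {set P}) : is_chain c -> c != set0 ->
  exists2 z, z \in c & forall u, u \in c :\ z -> (z < u)%O.
Proof.
move=> /is_chainP cc /set0Pn[z0 z0c].
have [z zc zmin] := arg_minnP rho z0c; exists z => // u /setD1P[uz uc].
case: (comparable_ltgtP (cc z u zc uc)) => // [/rho_lt|e]; last by rewrite e eqxx in uz.
by rewrite ltnNge zmin.
Qed.

Lemma interval_chain_setU1 x y z c : (x < z)%O -> (z < y)%O ->
  interval_chain z y c -> interval_chain x y (z |: c).
Proof.
move=> xz zy /andP[cc /subsetP cs]; apply/andP; split.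
  by apply: is_chain_setU1 => // u /cs; rewrite inE => /andP[/ltW zu _]; apply: le_comparable.
apply/subsetP=> u /setU1P[->|/cs]; rewrite !inE ?xz //.
by case/andP=> zu ->; rewrite (lt_trans xz).
Qed.

Lemma interval_chain_min x y c : interval_chain x y c -> c != set0 ->
  exists z, [/\ z \in c, (x < z)%O, (z < y)%O & interval_chain z y (c :\ z)].
Proof.
case/andP=> cc /subsetP cs c0; have [z zc zmin] := chain_min cc c0; exists z.
have := cs z zc; rewrite inE => /andP[xz zy]; split=> //; apply/andP; split.
  by apply: is_chainS cc; apply: subsetDl.
apply/subsetP=> u uc; rewrite inE zmin //=.
by move: uc; rewrite inE => /andP[_ /cs]; rewrite inE => /andP[].
Qed.

Lemma interval_chain_card x y c : (x < y)%O -> interval_chain x y c ->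
  (#|c| + rho x < rho y)%N.
Proof.
have [m] := ubnP #|c|; elim: m x c => // m IHm x c cm xy ic.
have [->|c0] := eqVneq c set0; first by rewrite cards0 rho_lt.
have [z [zc xz zy iz]] := interval_chain_min ic c0.
move: cm; rewrite (cardsD1 z c) zc add1n ltnS => cm.
by have := IHm z _ cm zy iz; have := rho_lt xz; lia.
Qed.

(** A chain with as many elements as the ranks allow cannot skip a level, so its least element
    covers [x]. *)
Lemma interval_chain_cov x y r c : rho y = ((rho x) + r.+2)%N ->
  interval_chain x y c -> #|c| = r.+1 ->
  exists z, [/\ z \in c, cov x z, (z < y)%O & interval_chain z y (c :\ z)].
Proof.
move=> ryx ic cr; have c0 : c != set0 by rewrite -card_gt0 cr.
have [z [zc xz zy iz]] := interval_chain_min ic c0; exists z; split=> //.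
rewrite /cov xz /=; have := interval_chain_card zy iz; have := rho_lt xz.
by move: cr; rewrite (cardsD1 z c) zc add1n; lia.
Qed.

Lemma cov_chain_uniq x (c : {set P}) z z' : is_chain c -> z \in c -> z' \in c ->
  cov x z -> cov x z' -> z = z'.
Proof.
move=> /is_chainP cc zc z'c xz xz'.
have e : rho z = rho z' by rewrite (cov_rho xz) (cov_rho xz').
by have /orP[/le_rho_eq|/le_rho_eq] := cc z z' zc z'c => -> //.
Qed.

(** * Boundary coefficients and fundamental cycles *)

Definition bsign (c : {set P}) (t : P) : rat := (-1) ^+ #|[set u in c | (u < t)%O]|.

(* The coefficient of a face c in the boundary of a chain with coefficients f. *)
Definition bcoef (f : {set P} -> rat) (c : {set P}) : rat :=
  \sum_(t | t \notin c) bsign c t * f (t |: c).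

Lemma bsign_setU1 (c : {set P}) z t : z \notin c -> (z < t)%O -> bsign (z |: c) t = - bsign c t.
Proof.
move=> zc zt; rewrite /bsign.
have -> : [set u in z |: c | (u < t)%O] = z |: [set u in c | (u < t)%O].
  by apply/setP=> u; rewrite !inE; case: eqVneq => // ->; rewrite zt.
by rewrite cardsU1 inE negb_and zc add1n exprS mulN1r.
Qed.

Lemma bsign_min (c : {set P}) t : {in c, forall u, (t < u)%O} -> bsign c t = 1.
Proof.
move=> h; rewrite /bsign (_ : [set _ in _ | _] = set0) ?cards0 //.
apply/setP=> u; rewrite !inE; apply/negbTE/negP=> /andP[/h tu /lt_gtF].
by rewrite tu.
Qed.

Variable lam : P -> P -> rat.

(* The coefficients of the fundamental cycle of (x, y), where y has rank      *)
(* r + 1 in [x, y]: on a maximal chain it is the product of the weights lam   *)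
(* of its covering steps.                                                     *)
Fixpoint fcyc (r : nat) (x y : P) (c : {set P}) : rat :=
  if r is r'.+1 then \sum_(z in c | cov x z) lam x z * fcyc r' z y (c :\ z)
  else ((c == set0) && (x < y)%O)%:R * lam x y.

Lemma fcyc0 x y c : fcyc 0 x y c = ((c == set0) && (x < y)%O)%:R * lam x y.
Proof. by []. Qed.

Lemma fcycS r x y c :
  fcyc r.+1 x y c = \sum_(z in c | cov x z) lam x z * fcyc r z y (c :\ z).
Proof. by []. Qed.

Arguments fcyc : simpl never.

Lemma fcyc_supp r x y c : fcyc r x y c != 0 ->
  [/\ (x < y)%O, interval_chain x y c & #|c| = r].
Proof.
elim: r x c => [|r IHr] x c; rewrite ?fcyc0 ?fcycS.
  case: (c =P set0) => [->|_]; last by rewrite mul0r eqxx.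
  case xy: (x < y)%O; last by rewrite mul0r eqxx.
  move=> _; split; rewrite ?cards0 // /interval_chain sub0set andbT.
  by apply/is_chainP=> u v; rewrite inE.
case: (pickP [pred z | [&& z \in c, cov x z & fcyc r z y (c :\ z) != 0]]).
  move=> z /and3P[zc /covW xz /IHr[zy iz cr]] _; split.
  - exact: lt_trans zy.
  - by rewrite -(setD1K zc); apply: interval_chain_setU1.
  - by rewrite (cardsD1 z) zc cr.
move=> none; rewrite big1 ?eqxx // => z /andP[zc xz].
have /negbT := none z; rewrite /= zc xz /= negbK => /eqP->; exact: mulr0.
Qed.

(** The defining sum has a single term: two covers of [x] in one chain have equal rank, hence
    coincide. *)
Lemma fcyc_setU1 r x y z c : cov x z -> interval_chain z y c ->
  fcyc r.+1 x y (z |: c) = lam x z * fcyc r z y c.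
Proof.
move=> xz ic; have zc : z \notin c.
  by apply: contraTN ic => zc; rewrite /interval_chain negb_and; apply/orP; right;
     apply/subsetPn; exists z; rewrite // inE ltxx.
have cc : is_chain (z |: c).
  case/andP: ic => cc /subsetP cs; apply: is_chain_setU1 => // u /cs.
  by rewrite inE => /andP[/ltW/le_comparable].
rewrite fcycS (bigD1 z) /=; last by rewrite setU11.
rewrite setU1K // big1 ?addr0 // => z' /andP[/andP[z'c xz'] nz].
by rewrite (cov_chain_uniq cc z'c (setU11 z c) xz' xz) eqxx in nz.
Qed.

Hypothesis cov_ex : forall x y, (x < y)%O -> exists2 z, cov x z & (z <= y)%O.
Hypothesis lam_neq0 : forall x z, cov x z -> lam x z != 0.
Hypothesis lam_diamond : forall x w, rho w = (rho x).+2 ->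
  \sum_(z | cov x z && cov z w) lam x z * lam z w = 0.

Lemma fcyc_neq0 r x y : (x < y)%O -> rho y = (rho x + r.+1)%N ->
  exists2 c, fcyc r x y c != 0 & interval_chain x y c.
Proof.
elim: r x => [|r IHr] x xy ryx.
  exists set0; last first.
    by rewrite /interval_chain sub0set andbT; apply/is_chainP=> u v; rewrite inE.
  rewrite fcyc0 eqxx xy mul1r; apply: lam_neq0.
  by rewrite /cov xy ryx addn1 /=.
have [z xz zy] := cov_ex xy.
have {}zy : (z < y)%O.
  rewrite lt_neqAle zy andbT; apply/eqP=> e.
  by have := cov_rho xz; rewrite e ryx; lia.
have [|c fc ic] := IHr z zy; first by rewrite (cov_rho xz); lia.
exists (z |: c); last by apply: interval_chain_setU1 => //; apply: covW.
by rewrite fcyc_setU1 // mulf_neq0 ?lam_neq0.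
Qed.

(** Induction on the length. Elements added above the lowest step are handled by the induction
    hypothesis in a shorter interval; those added at the lowest step cancel by the diamond
    relation. *)
Lemma fcyc_cycle r x y c : rho y = (rho x + r.+2)%N -> bcoef (fcyc r.+1 x y) c = 0.
Proof.
elim: r x c => [|r IHr] x c ryx; rewrite /bcoef.
  have [c0|[z zc]] := set_0Vmem c; last first.
    rewrite big1 // => t tc; have [->|nz] := eqVneq (fcyc 1 x y (t |: c)) 0.
      exact: mulr0.
    by have [_ _] := fcyc_supp nz; rewrite cardsU1 tc (cardsD1 z) zc.
  rewrite c0 -[RHS](lam_diamond (x := x) (w := y)); last by rewrite ryx; lia.
  rewrite [RHS]big_mkcond [LHS]big_mkcond; apply: eq_bigr => t _.
  rewrite inE bsign_min ?mul1r ?fcycS; last by move=> u; rewrite inE.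
  rewrite setU0; case: ifP => [/andP[xt ty]|nt].
    rewrite (big_pred1 t) ?fcyc0 ?setDv ?eqxx ?(covW ty) ?mul1r // => u.
    by rewrite !inE; case: eqVneq => [->|].
  rewrite big1 // => u; rewrite inE => /andP[/eqP->] xt; move: nt; rewrite fcyc0 xt /=.
  case ty: (t < y)%O; last by rewrite andbF mul0r mulr0.
  by rewrite /cov ty ryx (cov_rho xt) addn2 eqxx.
(* Split according to whether the removed element covers x or not. *)
transitivity (\sum_(t | (t \notin c) && cov x t) lam x t * fcyc r.+1 t y c
   - \sum_(z in c | cov x z) lam x z * bcoef (fcyc r.+1 z y) (c :\ z)).
  have E t : t \notin c -> fcyc r.+2 x y (t |: c) =
      (if cov x t then lam x t * fcyc r.+1 t y c else 0) +
      \sum_(z in c | cov x z) lam x z * fcyc r.+1 z y (t |: (c :\ z)).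
    move=> tc; rewrite fcycS [LHS]big_mkcondr big_setU1 //=.
    rewrite setU1K // [in RHS]big_mkcondr /=; congr (_ + _); apply: eq_bigr => z zc.
    rewrite setDUl; case: ifP => // _; congr (_ * fcyc r.+1 _ _ (_ :|: _)).
    by apply/setP=> u; rewrite !inE; case: (eqVneq u t) => [->|]; rewrite ?andbT ?andbF //; apply: contraNneq tc => ->.
  under eq_bigr => t tc do rewrite (E t tc) mulrDr.
  rewrite big_split /=; congr (_ + _).
    rewrite [RHS]big_mkcondr /=; apply: eq_bigr => t tc; case: ifP => xt; last exact: mulr0.
    have [->|nz] := eqVneq (fcyc r.+1 t y c) 0; first by rewrite !mulr0.
    have [_ /andP[_ /subsetP cs] _] := fcyc_supp nz.
    by rewrite bsign_min ?mul1r // => u /cs; rewrite inE => /andP[].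
  under eq_bigr do rewrite mulr_sumr.
  rewrite exchange_big -sumrN /=; apply: eq_bigr => z /andP[zc xz].
  rewrite /bcoef mulr_sumr -sumrN [RHS](bigD1 z) /=; last by rewrite !inE eqxx.
  rewrite [X in _ = X + _](_ : _ = 0) ?add0r; last first.
    have [->|nz] := eqVneq (fcyc r.+1 z y (z |: c :\ z)) 0; first by rewrite !mulr0 oppr0.
    have [_ /andP[_ /subsetP cs] _] := fcyc_supp nz.
    by have := cs z (setU11 z _); rewrite inE ltxx.
  apply: eq_big => [t|t tc].
    by rewrite !inE; case: (eqVneq t z) => [->|]; rewrite ?zc ?andbT.
  have [->|nz] := eqVneq (fcyc r.+1 z y (t |: c :\ z)) 0; first by rewrite !mulr0 oppr0.
  have [_ /andP[_ /subsetP cs] _] := fcyc_supp nz.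
  have := cs t (setU11 t _); rewrite inE => /andP[zt _].
  rewrite -{1}(setD1K zc) bsign_setU1 ?setD11 //; ring.
rewrite [X in _ - X]big1 ?subr0; last first.
  by move=> z /andP[zc xz]; rewrite IHr ?mulr0 // (cov_rho xz) ryx; lia.
(* Terms with [t] in [c] may be added, as a chain of (t, y) never contains [t]. Expanding the next
   step [w] then leaves, for each [w], the diamond sum of (x, w). *)
transitivity (\sum_(t | cov x t) lam x t * fcyc r.+1 t y c).
  rewrite [RHS](bigID (mem c)) /= [X in X + _]big1 ?add0r.
    by apply: eq_bigl => t; rewrite andbC.
  move=> t /andP[_ tc]; have [->|nz] := eqVneq (fcyc r.+1 t y c) 0; first exact: mulr0.
  have [_ /andP[_ /subsetP cs] _] := fcyc_supp nz.
  by have := cs t tc; rewrite inE ltxx.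
under eq_bigr => t _ do rewrite fcycS mulr_sumr.
under eq_bigr => t _ do under eq_bigr => w _ do rewrite mulrA.
rewrite (exchange_big_dep (mem c)) /=; last by move=> t w _ /andP[].
rewrite big1 // => w wc; rewrite -mulr_suml.
have [rw|rw] := eqVneq (rho w) (rho x).+2.
  rewrite (eq_bigl (fun t => cov x t && cov t w)) ?lam_diamond ?mul0r // => t.
  by rewrite wc.
rewrite big1 ?mul0r // => t /and3P[xt _ tw].
by rewrite (cov_rho tw) (cov_rho xt) eqxx in rw.
Qed.

(* Exactness at the elements covering x: it says that the chains of [x, y]    *)
(* are connected through adjacent ones.                                       *)
Hypothesis lam_exact : forall x y (a : P -> rat), (x < y)%O ->
  (rho x + 2 <= rho y)%N ->
  (forall w, (w <= y)%O -> rho w = (rho x).+2 ->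
     \sum_(z | cov x z && cov z w) a z * lam z w = 0) ->
  exists b, forall z, cov x z -> (z <= y)%O -> a z = b * lam x z.

(** The chains of [f] that start with a cover [z] of [x] form a top cycle of (z, y), by induction a
    multiple [a z] of the fundamental one. The cycle condition on [f] at faces without their lowest
    element says that [a] satisfies the diamond relations, so [lam_exact] makes [a] proportional to
    [lam x]. *)
Lemma fcyc_uniq r x y (f : {set P} -> rat) : (x < y)%O -> rho y = (rho x + r.+1)%N ->
  (forall c, f c != 0 -> interval_chain x y c && (#|c| == r)) ->
  ((0 < r)%N -> forall c, bcoef f c = 0) ->
  exists b, forall c, f c = b * fcyc r x y c.
Proof.
elim: r x f => [|r IHr] x f xy ryx fs fb.
  have xy1 : cov x y by rewrite /cov xy ryx addn1 /=.
  exists (f set0 / lam x y) => c; rewrite fcyc0 xy andbT.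
  have [->|c0] := eqVneq c set0; first by rewrite mul1r divfK ?lam_neq0.
  rewrite mul0r mulr0; apply/eqP; apply: contraNT c0 => /fs /andP[_].
  by rewrite cards_eq0.
have {}fb := fb isT.
pose g z c := if interval_chain z y c then f (z |: c) else 0.
have gE z : cov x z -> (z < y)%O -> exists b, forall c, g z c = b * fcyc r z y c.
  move=> xz zy; apply: IHr => //; first by rewrite ryx (cov_rho xz); lia.
    move=> c; rewrite /g; case: ifP; last by rewrite eqxx.
    move=> ic /fs /andP[_]; rewrite cardsU1.
    case/andP: ic => _ /subsetP cs; case zc: (z \in c).
      by have := cs z zc; rewrite inE ltxx.
    by rewrite add1n.
  move=> r0 c; have [ic|nic] := boolP (interval_chain z y c); last first.
    rewrite /bcoef big1 // => t tc; rewrite /g; case: ifP => [/andP[cc cs]|_].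
      case/negP: nic; apply/andP; split; first by apply: is_chainS cc; apply: subsetUr.
      by apply: subset_trans cs; apply: subsetUr.
    exact: mulr0.
  have zc : z \notin c.
    apply/negP=> zc; case/andP: ic => _ /subsetP/(_ z zc).
    by rewrite inE ltxx.
  (* The boundary of [g z] at [c] is minus the boundary of [f] at [z |: c]: every added element lies
     above [z], which costs one sign. *)
  apply/eqP; rewrite -oppr_eq0 -(fb (z |: c)) -sumrN /bcoef; apply/eqP.
  rewrite [LHS](bigD1 z) //= [X in X + _](_ : _ = 0) ?add0r; last first.
    rewrite /g; case: ifP => [/andP[_ /subsetP/(_ z)]|]; last by rewrite mulr0 oppr0.
    by rewrite setU11 inE ltxx => /(_ isT).
  apply: eq_big => [t|t]; first by rewrite !inE negb_or andbC.
  case/andP=> tc tz; rewrite /g; case: ifP => it.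
    case/andP: (it) => _ /subsetP/(_ t (setU11 _ _)); rewrite inE => /andP[zt _].
    by rewrite bsign_setU1 // mulNr setUCA.
  rewrite mulr0 oppr0; apply/esym.
  have [->|/fs/andP[ic' /eqP cr]] := eqVneq (f (t |: (z |: c))) 0; first exact: mulr0.
  case/negP: it; have [|u [uc xu uy iu]] := interval_chain_cov _ ic' cr.
    by rewrite ryx.
  have ez : u = z.
    by case/andP: ic' => cc _; apply: (cov_chain_uniq cc uc _ xu xz); rewrite !inE eqxx orbT.
  move: iu; rewrite ez setUCA setU1K // !inE negb_or eq_sym tz //.
(* The ratio can be read off at any chain where the fundamental cycle is nonzero; [fcyc_neq0] rules
   out the default 0 for the [z] in question. *)
pose a z := if [pick c | fcyc r z y c != 0] is Some c then g z c / fcyc r z y c else 0.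
have gaE z c : cov x z -> (z < y)%O -> g z c = a z * fcyc r z y c.
  move=> xz zy; have [b bE] := gE z xz zy; rewrite bE; congr (_ * _).
  rewrite /a; case: pickP => [c' nz|none]; first by rewrite bE mulfK.
  have [|c' nz _] := fcyc_neq0 (r := r) zy; first by rewrite ryx (cov_rho xz); lia.
  by rewrite none in nz.
have [|w wy rw|b bE] := lam_exact (a := a) xy; first by rewrite ryx; lia.
  (* If [w = y], the chains are single elements and the relation is the boundary at the empty face.
     Otherwise it is the boundary at [w |: c], divided by a nonzero coefficient of the cycle of (w,
     y). *)
  move: wy; rewrite le_eqVlt => /predU1P[ew|wy].
    have r0 : r = 0%N by move: rw; rewrite ew ryx; lia.
    subst w r; rewrite -[RHS](fb set0) /bcoef [LHS]big_mkcond [RHS]big_mkcond.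
    apply: eq_bigr => t _; rewrite inE bsign_min ?mul1r ?setU0; last by move=> u; rewrite inE.
    case: ifP => [/andP[xt ty]|nt].
      have := gaE t set0 xt (covW ty); rewrite /g fcyc0 eqxx (covW ty) mul1r setU0 => <-.
      rewrite /interval_chain sub0set andbT; case: is_chainP => // [[]] u v.
      by rewrite inE.
    apply/esym/eqP; apply: contraFT nt => /fs/andP[ic /eqP cr].
    have [|u [+ xu uy _]] := interval_chain_cov _ ic cr; first by rewrite ryx.
    by rewrite inE => /eqP eu; rewrite -eu xu /cov uy ryx (cov_rho xu) addn2 eqxx.
  have r1 : r = r.-1.+1 by have := rho_lt wy; rewrite rw ryx; lia.
  have [|c nz ic] := fcyc_neq0 (r := r.-1) wy; first by rewrite ryx rw; lia.
  apply: (mulIf nz); rewrite mul0r -[RHS](fb (w |: c)) /bcoef.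
  rewrite mulr_suml [LHS]big_mkcond [RHS]big_mkcond.
  have [_ _ cr] := fcyc_supp nz.
  have wc : w \notin c.
    by apply/negP=> wc; case/andP: ic => _ /subsetP/(_ w wc); rewrite inE ltxx.
  apply: eq_bigr => t _; case: ifP => [/andP[xt tw]|nt].
    have itw : interval_chain t y (w |: c).
      by apply: interval_chain_setU1 => //; apply: covW.
    have ty : (t < y)%O := lt_trans (covW tw) wy.
    have tc : t \notin w |: c.
      by apply/negP=> tc; case/andP: itw => _ /subsetP/(_ t tc); rewrite inE ltxx.
    rewrite tc bsign_min ?mul1r; last first.
      by case/andP: itw => _ /subsetP cs u /cs; rewrite inE => /andP[].
    have := gaE t (w |: c) xt ty; rewrite /g itw r1 fcyc_setU1 // => ->; ring.
  case: ifP => // tc; apply/esym/eqP.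
  have [->|/fs/andP[ic' /eqP cr']] := eqVneq (f (t |: (w |: c))) 0; first by rewrite mulr0.
  have [|u [+ xu uy iu]] := interval_chain_cov _ ic' cr'; first by rewrite ryx.
  rewrite !inE => /or3P[/eqP eu|/eqP eu|uc].
  - case/negP: nt; rewrite -eu xu; move: iu; rewrite eu setU1K ?tc //.
    case/andP=> _ /subsetP/(_ w (setU11 _ _)); rewrite inE => /andP[uw _].
    by rewrite /cov uw rw -eu (cov_rho xu) eqxx.
  - by have := cov_rho xu; rewrite eu rw => -[/esym/n_Sn].
  - case/andP: ic => _ /subsetP/(_ u uc); rewrite inE => /andP[/rho_lt].
    by rewrite rw (cov_rho xu) ltnNge leqnSn.
exists b => c; have [fc0|/fs/andP[ic /eqP cr]] := eqVneq (f c) 0.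
  rewrite fc0; apply/esym/eqP; rewrite mulf_eq0; apply/orP.
  have [_|nz] := eqVneq (fcyc r.+1 x y c) 0; [by right | left].
  have [_ ic cr] := fcyc_supp nz.
  have [|z [zc xz zy iz]] := interval_chain_cov _ ic cr; first by rewrite ryx.
  move: nz fc0; rewrite -{1 2}(setD1K zc) fcyc_setU1 // => nz.
  have := gaE z (c :\ z) xz zy; rewrite /g iz => -> /eqP.
  rewrite bE ?(ltW zy) // -mulrA mulf_eq0 (negbTE nz) orbF => /eqP-> //.
have [|z [zc xz zy iz]] := interval_chain_cov _ ic cr; first by rewrite ryx.
have := gaE z (c :\ z) xz zy; rewrite /g iz setD1K // => ->.
by rewrite bE ?(ltW zy) // -{2}(setD1K zc) fcyc_setU1 // mulrA.
Qed.

(** * From functions on chains to homology spaces *)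

Local Notation N := #|{: {set P}}|.

Definition fcyc_row (r : nat) (x y : P) : 'rV[rat]_N :=
  \row_i fcyc r x y (enum_val i).

Lemma chain_spaceP x y j (u : 'rV[rat]_N) :
  reflect (forall c, u 0 (enum_rank c) != 0 -> is_face x y j c)
          (u <= chain_space x y j)%MS.
Proof.
apply: (iffP idP) => [us c|us].
  apply: contraR => nf.
  have: (chain_space x y j <= kermx (delta_mx (enum_rank c) 0 : 'cV[rat]_N))%MS.
    apply/sumsmx_subP=> c' f'; rewrite genmxE; apply/sub_kermxP.
    rewrite /basis_vec mul_delta_mx_0 // (inj_eq enum_rank_inj).
    by apply: contraNneq nf => <-.
  move/(submx_trans us)/sub_kermxP/matrixP/(_ 0 0); rewrite -colE !mxE => ->.
  exact: eqxx.
rewrite [u]row_sum_delta summx_sub // => i _.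
have [->|nz] := eqVneq (u 0 i) 0; first by rewrite scale0r sub0mx.
rewrite scalemx_sub //; apply: (sumsmx_sup (enum_val i)).
  by apply: us; rewrite enum_valK.
by rewrite genmxE /basis_vec enum_valK.
Qed.

Lemma boundary_coef (u : 'rV[rat]_N) c :
  (u *m boundary P) 0 (enum_rank c) = bcoef (fun c' => u 0 (enum_rank c')) c.
Proof.
rewrite mxE (reindex (@enum_rank {set P})) /=; last first.
  by apply: onW_bij; apply: enum_rank_bij.
under eq_bigr => c' _.
  rewrite mxE enum_rankK /boundary_of summxE mulr_sumr.
  under eq_bigr => z _ do rewrite !mxE eqxx /= (inj_eq enum_rank_inj) mulrA.
  over.
rewrite (exchange_big_dep predT) //= [RHS]big_mkcond; apply: eq_bigr => z _.
rewrite (eq_bigr (fun c' => if c' == z |: c then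
    (if z \notin c then bsign c z * u 0 (enum_rank (z |: c)) else 0) else 0)).
  rewrite -big_mkcondr (big_pred1 (z |: c)) // => c' /=.
  by case: eqVneq => [->|]; rewrite ?setU11 ?andbF.
move=> c' zc'; have [->|ne] := eqVneq c' (z |: c).
  have [zc|zc] := boolP (z \in c); rewrite /=.
    case: eqP => [e|_]; last exact: mulr0.
    by move: zc; rewrite e !inE eqxx.
  rewrite setU1K // eqxx mulr1 mulrC; congr (_ * _).
  rewrite /bsign; congr (_ ^+ _); apply: eq_card => t; rewrite !inE.
  by case: eqVneq => // ->; rewrite ltxx (negbTE zc).
case: eqP => [e|_]; last exact: mulr0.
by case/eqP: ne; rewrite e setD1K.
Qed.

Definition homology_generator (x y : P) (j : int) (u : 'rV[rat]_N) : Prop :=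
  [/\ bound_space x y j = 0, (cycle_space x y j :=: u)%MS & u != 0].

(** No face of (x, y) has dimension [j + 1], since a chain there has at most [r] elements; so
    boundaries vanish, and [fcyc_uniq] describes all cycles. *)
Lemma fcyc_generator r x y j : (x < y)%O -> rho y = (rho x + r.+1)%N ->
  j + 1 = r%:Z -> homology_generator x y j (fcyc_row r x y).
Proof.
move=> xy ryx jr; have rowE c : fcyc_row r x y 0 (enum_rank c) = fcyc r x y c.
  by rewrite mxE enum_rankK.
split; last 1 first.
- have [c nz _] := fcyc_neq0 xy ryx; apply: contraNneq nz => e.
  by rewrite -rowE e mxE.
- rewrite /bound_space (_ : chain_space _ _ _ = 0) ?mul0mx //.
  apply/eqP; rewrite -submx0; apply/row_subP=> i.
  have /chain_spaceP us : (row i (chain_space x y (j + 1)) <= chain_space x y (j + 1))%MS.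
    exact: row_sub.
  rewrite submx0; apply/eqP/rowP=> k; rewrite [RHS]mxE; apply/eqP.
  apply/negPn/negP; rewrite -(enum_valK k) => /us /and3P[cc cs].
  have := interval_chain_card xy (introT andP (conj cc cs)).
  by rewrite jr ryx => + /eqP; lia.
apply/eqmxP/andP; split; last first.
  rewrite sub_capmx; apply/andP; split.
    apply/chain_spaceP=> c; rewrite rowE => /fcyc_supp[_ /andP[cc cs] cr].
    by rewrite /is_face cc cs cr jr eqxx.
  apply/sub_kermxP/rowP=> k; rewrite -(enum_valK k) boundary_coef [RHS]mxE.
  rewrite /bcoef; under eq_bigr do rewrite rowE.
  (* For [r = 0] the cycle is supported on the empty chain, whose boundary is zero; [fcyc_cycle]
     starts at length one. *)
  case: (r) ryx jr => [|r'] ryx jr; last exact: fcyc_cycle.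
  rewrite big1 // => t tc; have [->|nz] := eqVneq (fcyc 0 x y (t |: enum_val k)) 0.
    exact: mulr0.
  by have [_ _] := fcyc_supp nz; rewrite cardsU1 tc.
apply/row_subP=> i; set u := row i _.
have : (u <= cycle_space x y j)%MS by apply: row_sub.
rewrite sub_capmx => /andP[/chain_spaceP us /sub_kermxP ub].
have [||b bE] := fcyc_uniq (f := fun c => u 0 (enum_rank c)) xy ryx.
- by move=> c /us /and3P[cc cs /eqP]; rewrite /interval_chain cc cs jr => -[->] /=.
- by move=> _ c; rewrite -boundary_coef ub mxE.
apply/submxP; exists (const_mx b); apply/rowP=> k.
by rewrite [RHS]mxE big_ord1 [const_mx _ _ _]mxE -(enum_valK k) bE rowE.
Qed.

(** * Group action on fundamental cycles *)

Section Equivariance.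

Variables (gT : finGroupType) (to : {action gT &-> P}) (mu : P -> gT -> rat).
Hypothesis to_mono : forall a, {mono to^~ a : x y / (x <= y)%O}.
Hypothesis rho_act : forall a x, rho (to x a) = rho x.
Hypothesis lam_act : forall a x z, cov x z ->
  lam (to x a) (to z a) = mu x a * lam x z.
Hypothesis mu1 : forall a x z, (x < z)%O -> mu z a = 1.

Lemma cov_act a x z : cov (to x a) (to z a) = cov x z.
Proof. by rewrite /cov (to_mono_lt to_mono) !rho_act. Qed.

(** Only the first step of a chain starts at [x]; every later one starts above [x], where the factor
    [mu] is 1. *)
Lemma fcyc_act r a x y c : rho y = (rho x + r.+1)%N ->
  fcyc r (to x a) (to y a) (to^*%act c a) = mu x a * fcyc r x y c.
Proof.
elim: r x c => [|r IHr] x c ryx.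
  rewrite !fcyc0 imset_eq0 (to_mono_lt to_mono).
  case xy: (x < y)%O; last by rewrite andbF !mul0r mulr0.
  by rewrite lam_act 1?mulrCA // /cov xy ryx addn1 /=.
rewrite !fcycS mulr_sumr big_mkcondr /= big_imset /=; last first.
  by move=> u v _ _; apply: act_inj.
rewrite [RHS]big_mkcondr; apply: eq_bigr => z zc; rewrite cov_act.
case: ifP => // xz; rewrite lam_act // -mulrA; congr (_ * (_ * _)).
have -> : [set to x a | x in c] :\ to z a = to^*%act (c :\ z) a.
  apply/setP=> u; rewrite -[u](actKV to a) !inE (inj_eq (act_inj to a)).
  by rewrite ![in RHS](mem_imset _ _ (act_inj to a)) // !inE (mem_imset _ _ (act_inj to a)).
rewrite IHr; last by rewrite (cov_rho xz) ryx; lia.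
by rewrite (mu1 a (covW xz)) mul1r.
Qed.

Hypothesis mu_sqr : forall a x, mu x a * mu x a = 1.

(** Transport puts the coefficient of [c] on the image of [c], so the factor of [fcyc_act] enters
    inverted; by [mu_sqr] it is its own inverse. *)
Lemma fcyc_row_act r a x y : rho y = (rho x + r.+1)%N ->
  fcyc_row r x y *m perm_module_mx (to^*)%act a =
  mu x a *: fcyc_row r (to x a) (to y a).
Proof.
move=> ryx; rewrite [fcyc_row r x y]row_sum_delta mulmx_suml; apply/rowP=> k.
have inj : injective (fun c : {set P} => to^*%act c a) := act_inj _ a.
rewrite -(enum_valK k) -(actKV (to^*)%act a (enum_val k)).
set c := to^*%act (enum_val k) _; rewrite [RHS]mxE [fcyc_row _ (to x a) _ _ _]mxE enum_rankK.
rewrite fcyc_act // mulrA mu_sqr mul1r summxE (bigD1 (enum_rank c)) //=.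
rewrite big1 ?addr0 => [|i ic].
  rewrite -scalemxAl [LHS]mxE [fcyc_row _ _ _ _ _]mxE enum_rankK -/(basis_vec c).
  by rewrite basis_vec_act /basis_vec mxE !eqxx /= mulr1.
rewrite -scalemxAl -(enum_valK i) -/(basis_vec (enum_val i)) basis_vec_act mxE.
rewrite [basis_vec _ _ _]mxE eqxx (inj_eq enum_rank_inj) (inj_eq inj) eq_sym.
by rewrite (negbTE (contraNneq _ ic)) ?mulr0 // => <-; rewrite enum_valK.
Qed.

End Equivariance.

End IncidenceSystem.

(** * Twisted permutation modules and sums of homology lines *)

Section TwistedPermutationModule.

Variables (gT : finGroupType) (X : finType) (to : {action gT &-> X}) (chi : gT -> rat).
Hypotheses (chi1 : chi 1%g = 1) (chiM : {morph chi : a b / (a * b)%g >-> a * b}).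

Lemma twisted_perm_mxP :
  mx_repr [set: gT] (fun a => chi a *: perm_module_mx to a).
Proof.
have [p1 pM] := perm_module_mxP to; split=> [|a b aG bG]; first by rewrite chi1 p1 scale1r.
by rewrite chiM pM // -scalemxAl -scalemxAr scalerA.
Qed.

Definition twisted_perm : mx_representation rat [set: gT] #|X| :=
  MxRepresentation twisted_perm_mxP.

End TwistedPermutationModule.

Section HomologySumTwistedPerm.

Variables (d : Order.disp_t) (P : finPOrderType d).
Variables (gT : finGroupType) (to : {action gT &-> P}).
Hypothesis to_mono : forall a, {mono to^~ a : x y / (x <= y)%O}.
Variables (T : {set P * P}) (j : int).
Hypothesis T_act : forall a p, p \in T -> (to p.1 a, to p.2 a) \in T.
Variables (X : finType) (toX : {action gT &-> X}) (phi : X -> P * P).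
Hypothesis phi_inj : injective phi.
Hypothesis phi_im : phi @: setT = T.
Hypothesis phi_act : forall a x, phi (toX x a) = (to (phi x).1 a, to (phi x).2 a).
Variables (chi : gT -> rat) (v : P * P -> 'rV[rat]_#|{: {set P}}|).
Hypotheses (chi1 : chi 1%g = 1) (chiM : {morph chi : a b / (a * b)%g >-> a * b}).
Hypothesis v_gen : forall p, p \in T -> homology_generator p.1 p.2 j (v p).
Hypothesis v_act : forall a p, p \in T ->
  v p *m perm_module_mx (to^*)%act a = chi a *: v (to p.1 a, to p.2 a).

Lemma generator_dim (x y : P) (u : 'rV_ _) : homology_generator x y j u ->
  homology_dim x y j = 1%N.
Proof.
case=> b0 cu u0; rewrite /homology_dim /homology_space genmxE.
have := mxrank_in_factmod (bound_space x y j) (cycle_space x y j).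
by rewrite b0 mxrank0 addn0 adds0mx cu rank_rV u0.
Qed.

Definition gclass (p : P * P) : 'rV[rat]_(homology_dim p.1 p.2 j) :=
  v p *m homology_class p.1 p.2 j.

Lemma gclass_lift p : p \in T -> gclass p *m homology_lift p.1 p.2 j = v p.
Proof.
move=> /v_gen[b0 cu _].
have vBZ : (v p <= bound_space p.1 p.2 j + cycle_space p.1 p.2 j)%MS.
  by rewrite (submx_trans _ (addsmxSr _ _)) // cu.
have := homology_classK vBZ.
by rewrite [X in (_ <= X)%MS]b0 submx0 subr_eq0 => /eqP.
Qed.

Lemma gclass_induced a p q : p \in T ->
  gclass p *m induced_mx to j a p q =
  if (to p.1 a, to p.2 a) == q then chi a *: gclass q else 0.
Proof.
move=> pT; rewrite /induced_mx; case: eqP => [<-|_]; last exact: mulmx0.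
by rewrite 2!(mulmxA (gclass p)) gclass_lift // v_act // -scalemxAl.
Qed.

(** The intertwiner [B] sends the basis vector of [x] to the class of the generator in the summand
    indexed by [phi x]. All summands are lines, so the dimensions agree and nonzero generators make
    [B] invertible. *)
Lemma homology_sum_twisted_perm :
  mx_rsim (twisted_perm toX chi1 chiM) (homology_sum to_mono j T_act).
Proof.
pose B := \mxrow_(t < #|T|)
  (\matrix_(i < #|X|) (if phi (enum_val i) == enum_val t then gclass (enum_val t) else 0)
     : 'M[rat]_(#|X|, homology_dim (enum_val t).1 (enum_val t).2 j)).
have phiT x : phi x \in T by rewrite -phi_im imset_f.
have row_free_B : row_free B.
  rewrite -kermx_eq0 -submx0; apply/row_subP=> i.
  have: (row i (kermx B) <= kermx B)%MS by apply: row_sub.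
  move: (row i _) => u /sub_kermxP uB; rewrite submx0; apply/eqP/rowP=> k.
  pose t := enum_rank_in (phiT (enum_val k)) (phi (enum_val k)).
  have tE : enum_val t = phi (enum_val k) by rewrite enum_rankK_in.
  have : submxrow (u *m B) t = 0 by rewrite uB submxrow0.
  rewrite mul_mxrow mxrowK mulmx_sum_row (bigD1 k) //= big1 ?addr0; last first.
    move=> k' kk'; rewrite rowK tE (inj_eq phi_inj) (inj_eq enum_val_inj).
    by rewrite (negbTE kk') scaler0.
  rewrite rowK tE eqxx => /(congr1 (mulmxr (homology_lift _ _ j))) /=.
  rewrite -scalemxAl gclass_lift ?enum_valP // mul0mx => /eqP.
  have [_ _ v0] := v_gen (phiT (enum_val k)).
  by rewrite scaler_eq0 (negbTE v0) orbF => /eqP->; rewrite mxE.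
have dimE : #|X| = homology_sum_dim T j.
  rewrite /homology_sum_dim (eq_bigr (fun=> 1%N)) => [|s _].
    by rewrite sum1_card card_ord -phi_im card_imset // cardsT.
  exact: generator_dim (v_gen (enum_valP s)).
exists B => // a _; rewrite /= /homology_sum_mx mul_mxrow_mxblock mul_mxrow.
apply/eq_mxrow=> t; apply/row_matrixP=> i.
have iT := phiT (enum_val i).
transitivity (if (to (phi (enum_val i)).1 a, to (phi (enum_val i)).2 a) == enum_val t
  then chi a *: gclass (enum_val t) else 0).
  rewrite -scalemxAl linearZ /= row_mul rowK -rowE rowK enum_rankK phi_act.
  by case: ifP => // _; rewrite scaler0.
rewrite linear_sum /= (bigD1 (enum_rank_in iT (phi (enum_val i)))) //=.
rewrite row_mul rowK enum_rankK_in // eqxx gclass_induced //.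
rewrite big1 ?addr0 // => s st; rewrite row_mul rowK ifN ?mul0mx //.
by apply: contraNneq st => e; rewrite -(inj_eq enum_val_inj) enum_rankK_in // e.
Qed.

End HomologySumTwistedPerm.

(** * Rank functions and gradedness *)

Section RankFunction.

Variables (d : Order.disp_t) (P : finTBPOrderType d) (rho : P -> nat).
Hypothesis rho_lt : forall x y, (x < y)%O -> (rho x < rho y)%N.
Hypothesis cov_ex : forall x y, (x < y)%O -> exists2 z, cov rho x z & (z <= y)%O.
Hypothesis rho_bot : rho \bot%O = 0%N.

Lemma inord_rho_inj (c : {set P}) m : is_chain c -> {in c, forall z, rho z <= m}%N ->
  {in c &, injective (fun z => inord (rho z) : 'I_m.+1)}.
Proof.
move=> /is_chainP cc cm u v uc vc /(congr1 val); rewrite /= !inordK ?ltnS ?cm // => e.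
by have /orP[/(le_rho_eq rho_lt)|/(le_rho_eq rho_lt)] := cc u v uc vc => -> //.
Qed.

Lemma chain_card_le (c : {set P}) m : is_chain c -> {in c, forall z, rho z <= m}%N ->
  (#|c| <= m.+1)%N.
Proof.
move=> cc cm; rewrite -(card_in_imset (inord_rho_inj cc cm)).
by rewrite -[X in (_ <= X)%N]card_ord max_card.
Qed.

Lemma saturated_chain x y : (x <= y)%O -> exists c : {set P},
  [/\ is_chain c, {in c, forall z, (x <= z <= y)%O} & #|c| = (rho y - rho x).+1].
Proof.
have [m] := ubnP (rho y - rho x); elim: m x => // m IHm x xm.
rewrite le_eqVlt => /predU1P[->|xy].
  exists [set y]; rewrite cards1 subnn; split=> // [|z].
    by apply/is_chainP=> u v /set1P-> /set1P->; apply: comparablexx.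
  by move=> /set1P->; rewrite lexx.
have [z xz zy] := cov_ex xy; have rz := cov_rho xz; have rxy := rho_lt xy.
have [|c [cc cz cn]] := IHm z _ zy; first by move: xm rxy; rewrite rz; lia.
have xc : x \notin c.
  by apply/negP=> /cz /andP[/(lt_le_trans (covW xz))]; rewrite ltxx.
exists (x |: c); split.
- apply: is_chain_setU1 => // u /cz /andP[zu _]; apply: le_comparable.
  exact: le_trans (ltW (covW xz)) zu.
- move=> u /setU1P[->|/cz /andP[zu ->]]; first by rewrite lexx ltW.
  by rewrite (le_trans (ltW (covW xz)) zu).
- by rewrite cardsU1 xc cn rz; move: rxy; lia.
Qed.

Lemma rk_rho x : rk x = rho x.
Proof.
apply/eqP; rewrite eqn_leq; apply/andP; split.
  apply/bigmax_leqP=> c /andP[cc /forall_inP cx].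
  have : (#|c| <= (rho x).+1)%N.
    by apply: chain_card_le => // z zc; apply: (rho_le rho_lt); apply: cx.
  by case: #|c|.
have [c [cc cx cn]] := saturated_chain (le0x x).
rewrite -[X in (X <= _)%N](_ : #|c|.-1 = rho x); last by rewrite cn rho_bot subn0.
apply: (@leq_bigmax_cond _ _ (fun c : {set P} => #|c|.-1)).
by rewrite cc /=; apply/forall_inP=> z /cx /andP[].
Qed.

(** A maximal chain meets every rank: a cover of [z] below the next chain element is comparable with
    the whole chain, hence already in it. *)
Lemma graded_rho : graded_of_rank P (rho \top%O).
Proof.
move=> c /maxsetP[cc cmax].
have memc z : {in c, forall u, (z >=< u)%O} -> z \in c.
  move=> zc; rewrite -(cmax (z |: c)) ?setU11 ?subsetUr //.
  exact: is_chain_setU1.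
have bc : \bot%O \in c by apply: memc => u _; apply/le_comparable/le0x.
have tc : \top%O \in c.
  by apply: memc => u _; rewrite comparable_sym; apply/le_comparable/lex1.
have hit m : (m <= rho \top%O)%N -> exists2 z, z \in c & rho z = m.
  elim: m => [|m IHm] mt; first by exists \bot%O.
  have [z zc zm] := IHm (ltnW mt).
  pose c' := [set u in c | (z < u)%O].
  have [||u] := @chain_min _ _ _ rho_lt c'.
  - by apply: is_chainS cc; apply/subsetP=> u; rewrite inE => /andP[].
  - apply/set0Pn; exists \top%O; rewrite inE tc /= lt_neqAle lex1 andbT.
    by apply: contraTneq mt => ez; rewrite -ez zm ltnn.
  rewrite inE => /andP[uc zu] umin; have [z' zz' z'u] := cov_ex zu.
  exists z'; last by rewrite (cov_rho zz') zm.
  apply: memc => v vc; have /orP[vz|] := is_chainP _ cc v z vc zc.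
    by rewrite comparable_sym; exact: le_comparable (le_trans vz (ltW (covW zz'))).
  rewrite le_eqVlt => /predU1P[<-|zv].
    by rewrite comparable_sym; exact: le_comparable (ltW (covW zz')).
  apply: le_comparable; apply: le_trans z'u _; have [->//|vu] := eqVneq v u.
  by apply/ltW/umin; rewrite !inE vu vc.
have cle : {in c, forall z, rho z <= rho \top%O}%N.
  by move=> z _; apply: (rho_le rho_lt); apply: lex1.
rewrite -(card_in_imset (inord_rho_inj cc cle)) -[RHS]card_ord.
apply: eq_card => m; rewrite [RHS]inE; apply/imsetP.
have [|z zc zm] := hit m; first by rewrite -ltnS.
by exists z => //; apply: val_inj; rewrite /= inordK zm.
Qed.

End RankFunction.

(** * Ordered set partitions *)

Section OspIndex.

Variable n : nat.
Implicit Types (s : seq {set 'I_n}) (x y z w : osp n).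

Definition idx s (i : 'I_n) : nat := find (fun B : {set 'I_n} => i \in B) s.

(** The union of the first [m] blocks. These unions form a flag from the empty set to [n] that
    determines the ordered partition, and they turn the order into reverse inclusion of flags. *)
Definition cut s (m : nat) : {set 'I_n} := [set i | idx s i < m]%N.

Definition cuts s : {set {set 'I_n}} := [set cut s m | m : 'I_(size s).+1].

Lemma idx_lt x i : (idx x i < size x)%N.
Proof.
rewrite -has_find; case: x => s /= /and3P[_ _ /eqP sT]; apply/hasP.
have : i \in [set: 'I_n] by rewrite inE.
by rewrite -sT bigcup_seq => /bigcupP[B Bs iB]; exists B.
Qed.

Lemma mem_nth_idx x i b : (b < size x)%N -> (i \in nth set0 x b) = (idx x i == b).
Proof.
move=> bx; have hi : (idx x i < size x)%N := idx_lt x i.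
have iB : i \in nth set0 x (idx x i) 
  by apply: (@nth_find _ set0 (fun B : {set 'I_n} => i \in B)); rewrite has_find.
apply/idP/eqP => [ib|<- //]; case: (x : osp n) bx hi iB ib => s /= /and3P[_ sd _] bx hi iB ib.
have /(pairwiseP set0) D := sd.
case: (ltngtP (idx s i) b) => // h.
  have := D (idx s i) b hi bx h; rewrite -setI_eq0 => /eqP/setP/(_ i).
  by rewrite !inE iB ib.
have := D b (idx s i) bx hi h; rewrite -setI_eq0 => /eqP/setP/(_ i).
by rewrite !inE iB ib.
Qed.

Lemma idx_onto x b : (b < size x)%N -> exists i, idx x i = b.
Proof.
move=> bx; have : nth set0 x b != set0.
  case: x bx => s /= /and3P[s0 _ _] bx; apply: contraNneq s0 => <-.
  exact: mem_nth.
by case/set0Pn=> i; rewrite mem_nth_idx // => /eqP; exists i.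
Qed.

Lemma osp_eq_idx x y : size x = size y -> idx x =1 idx y -> x = y.
Proof.
move=> e h; apply: val_inj; apply: (@eq_from_nth _ set0) => // b bx.
by apply/setP=> i; rewrite !mem_nth_idx ?h // -e.
Qed.

Lemma mem_cut s m i : (i \in cut s m) = (idx s i < m)%N.
Proof. by rewrite inE. Qed.

Lemma cut_inj x l m : (l <= size x)%N -> (m <= size x)%N -> cut x l = cut x m -> l = m.
Proof.
wlog lm : l m / (l < m)%N => [W lx mx e|lx mx /setP e].
  case: (ltngtP l m) => // h; first exact: W.
  by apply/esym/W.
have [i ix] := idx_onto (leq_trans lm mx).
by have := e i; rewrite !mem_cut ix ltnn lm.
Qed.

Lemma cutsP s A : reflect (exists2 m, (m <= size s)%N & A = cut s m) (A \in cuts s).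
Proof.
apply: (iffP imsetP) => [[m _ ->]|[m ms ->]]; first by exists m; rewrite // -ltnS.
by exists (Ordinal (ms : m < (size s).+1)%N).
Qed.

Lemma mem_cuts s m : (m <= size s)%N -> cut s m \in cuts s.
Proof. by move=> ms; apply/cutsP; exists m. Qed.

Lemma cut0 s : cut s 0 = set0.
Proof. by apply/setP=> i; rewrite !inE ltn0. Qed.

Lemma cut_size x : cut x (size x) = setT.
Proof. by apply/setP=> i; rewrite mem_cut idx_lt inE. Qed.

Lemma card_cuts x : #|cuts x| = (size x).+1.
Proof.
rewrite card_imset ?card_ord // => l m /cut_inj e; apply/val_inj/e; by rewrite -ltnS.
Qed.

(** The cuts missing [i] are those of index at most [idx x i]; their number recovers the block of
    [i] from the flag alone. *)
Lemma idx_cuts x i : #|[set A in cuts x | i \notin A]| = (idx x i).+1.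
Proof.
have -> : [set A in cuts x | i \notin A] = [set cut x (m : nat) | m : 'I_(idx x i).+1].
  apply/setP=> A; rewrite inE; apply/andP/imsetP.
    case=> /cutsP[m ms ->]; rewrite mem_cut -leqNgt => mi.
    by exists (Ordinal (mi : m < (idx x i).+1)%N).
  case=> m _ ->; rewrite mem_cut -leqNgt -ltnS ltn_ord mem_cuts //.
  by apply: leq_trans (ltnW (idx_lt x i)); rewrite -ltnS.
rewrite card_imset ?card_ord // => l m /cut_inj e; apply/val_inj/e.
  by apply: leq_trans (ltnW (idx_lt x i)); rewrite -ltnS.
by apply: leq_trans (ltnW (idx_lt x i)); rewrite -ltnS.
Qed.

Lemma cuts_inj x y : cuts x = cuts y -> x = y.
Proof.
move=> e; apply: osp_eq_idx => [|i]; apply: succn_inj.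
  by rewrite -!card_cuts e.
by rewrite -!idx_cuts e.
Qed.

Lemma idx_merge s k i : (k.+1 < size s)%N ->
  idx (merge_blocks k s) i = (idx s i - (k < idx s i))%N.
Proof.
move=> ks; have kE : size (take k s) = k by rewrite size_take ltnW // ltnW.
rewrite /idx /merge_blocks -[in RHS](cat_take_drop k s).
rewrite (@drop_nth _ set0 k s (ltnW ks)) (@drop_nth _ set0 k.+1 s ks).
rewrite !find_cat kE; case: ifP => [h|_].
  by rewrite has_find kE in h; rewrite ltnNge (ltnW h) subn0.
rewrite /= in_setU; case: (i \in nth set0 s k) => /=.
  by rewrite addn0 ltnn subn0.
by case: (i \in nth set0 s k.+1) => /=; lia.
Qed.

Definition mk x k (h : (k.+1 < size x)%N) : osp n := OSP (merge_osp (valP x) h).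

Lemma size_mk x k (h : (k.+1 < size x)%N) : size (mk h) = (size x).-1.
Proof. exact: merge_size. Qed.

Lemma merges_to_mk x k (h : (k.+1 < size x)%N) : merges_to x (mk h).
Proof. by apply/merges_toP; exists k. Qed.

Lemma merges_to_mkP x y :
  reflect (exists k, exists h : (k.+1 < size x)%N, y = mk h) (merges_to x y).
Proof.
apply: (iffP idP) => [/merges_toP[k h e]|[k [h ->]]]; last exact: merges_to_mk.
by exists k, h; apply: val_inj.
Qed.

(** Only the cut between the merged blocks disappears; [bump k.+1] numbers the others around it. *)
Lemma cut_merge s k m : (k.+1 < size s)%N ->
  cut (merge_blocks k s) m = cut s (bump k.+1 m).
Proof.
by move=> ks; apply/setP=> i; rewrite !mem_cut idx_merge // /bump; case: ltnP; lia.
Qed.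

Lemma cuts_mk x k (h : (k.+1 < size x)%N) : cuts (mk h) = cuts x :\ cut x k.+1.
Proof.
apply/setP=> A; rewrite in_setD1; apply/cutsP/andP.
  case=> m; rewrite size_mk => ms ->; rewrite cut_merge //.
  have bs : (bump k.+1 m <= size x)%N by rewrite /bump; case: ltnP; lia.
  split; last exact: mem_cuts.
  by apply/eqP=> /(cut_inj bs (ltnW h)); rewrite /bump; case: ltnP; lia.
case=> nk /cutsP[m ms eA]; subst A; exists (m - (k < m))%N.
  by rewrite size_mk; case: ltnP; lia.
rewrite cut_merge // (_ : bump _ _ = m) // /bump.
have mk : m != k.+1 by apply: contraNneq nk => ->.
by case: (ltnP k m); lia.
Qed.

Lemma mk_inj x k l (hk : (k.+1 < size x)%N) (hl : (l.+1 < size x)%N) :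
  mk hk = mk hl -> k = l.
Proof.
move/(congr1 (fun y : osp n => cuts y)); rewrite !cuts_mk => e.
apply: succn_inj; apply: (cut_inj (ltnW hk) (ltnW hl)); apply/eqP.
have : cut x l.+1 \notin cuts x :\ cut x k.+1 by rewrite e !inE eqxx.
by rewrite !inE negb_and mem_cuts ?(ltnW hl) // orbF negbK eq_sym.
Qed.

(** A merge deletes one cut. Conversely, a cut of [x] absent from [y] is neither empty nor full, so
    it separates two blocks of [x], and merging them stays below [y]. *)
Lemma osp_leP x y : reflect (cuts y \subset cuts x) (osp_le x y).
Proof.
apply: (iffP idP).
  case/connectP=> p; elim: p x => [|z p IHp] x /=; first by move=> _ ->.
  case/andP=> /merges_to_mkP[k [h ez]] /IHp{}IHp /IHp /subset_trans; apply.
  by rewrite ez cuts_mk subsetDl.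
have [m] := ubnP (size x); elim: m x => // m IHm x xm yx.
have [/cuts_inj->|ne] := eqVneq (cuts y) (cuts x); first exact: connect0.
have /properP[_ [A Ax Ay]] : cuts y \proper cuts x by rewrite properEneq ne.
case/cutsP: Ax Ay => l lx -> {A} Ay; case: l lx Ay => [|k] lx.
  by rewrite cut0 -(cut0 y) mem_cuts.
move=> Ay; have h : (k.+1 < size x)%N.
  rewrite ltn_neqAle lx andbT; apply: contraNneq Ay => ->.
  by rewrite cut_size -(cut_size y) mem_cuts.
apply: connect_trans (connect1 (merges_to_mk h)) (IHm _ _ _).
  by rewrite size_mk; have := ltn_trans _ h; lia.
by rewrite cuts_mk subsetD1 yx.
Qed.

Lemma osp_le_step x y : osp_le x y -> x != y ->
  exists k, exists h : (k.+1 < size x)%N, osp_le (mk h) y.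
Proof.
case/connectP=> -[|z p] /=; first by move=> _ ->; rewrite eqxx.
case/andP=> /merges_to_mkP[k [h ->]] zp yE _; exists k, h.
by apply/connectP; exists p.
Qed.

Lemma osp_le_merges x y : osp_le x y -> size x = (size y).+1 -> merges_to x y.
Proof.
move=> xy e; have nxy : x != y by apply: contraTneq (eqxx (size x)) => exy; rewrite {1}e exy; lia.
have [k [h zy]] := osp_le_step xy nxy.
suff <- : mk h = y by apply: merges_to_mk.
case/osp_le_size: zy => //; rewrite size_mk e /=; lia.
Qed.

Section TwoMerges.

Variables (x : osp n) (k l : nat) (kl : (k < l)%N).
Variables (hk : (k.+1 < size x)%N) (hl : (l.+1 < size x)%N).

Lemma two_merges_kP : (k.+1 < size (mk hl))%N.
Proof using kl hk hl. by rewrite size_mk; move: kl hl; lia. Qed.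

Lemma two_merges_lP : (l.-1.+1 < size (mk hk))%N.
Proof using kl hk hl. by rewrite size_mk; move: kl hl; lia. Qed.

Definition mk2 : osp n := mk two_merges_kP.

Lemma cuts_mk2 : cuts mk2 = cuts x :\ cut x l.+1 :\ cut x k.+1.
Proof.
rewrite cuts_mk cuts_mk cut_merge // (_ : bump _ _ = k.+1) // /bump.
by case: ltnP => //; move: kl; lia.
Qed.

(** Merging at [k] first moves the later merge from [l] to [l - 1]; this shift produces the opposite
    signs in the diamond relation. *)
Lemma mk2E : mk2 = mk two_merges_lP.
Proof.
apply: cuts_inj; rewrite cuts_mk2 cuts_mk cuts_mk cut_merge //.
rewrite (_ : bump _ _ = l.+1) 1?setDDl 1?setDDl 1?setUC // /bump.
by case: ltnP; move: kl; lia.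
Qed.

Lemma size_mk2 : size x = (size mk2).+2.
Proof. by rewrite !size_mk; move: hk; lia. Qed.

(** An intermediate partition loses a single cut, which must be one of the two that [mk2] loses. *)
Lemma between_mk2 z : (merges_to x z && merges_to z mk2) = (z == mk hk) || (z == mk hl).
Proof.
apply/andP/orP; last first.
  by case=> /eqP->; split; rewrite ?merges_to_mk // mk2E merges_to_mk.
case=> /merges_to_mkP[m [hm ->]] /connect1/osp_leP.
rewrite cuts_mk2 cuts_mk => /subsetP sub.
have : cut x m.+1 \notin cuts x :\ cut x l.+1 :\ cut x k.+1.
  by apply/negP=> /sub; rewrite !inE eqxx.
rewrite !inE !negb_and !negbK mem_cuts ?(ltnW hm) // orbF.
case/orP=> /eqP e; [left | right].
  have [em] := cut_inj (ltnW hm) (ltnW hk) e; subst m.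
  by apply/eqP/val_inj.
have [em] := cut_inj (ltnW hm) (ltnW hl) e; subst m.
by apply/eqP/val_inj.
Qed.

End TwoMerges.

End OspIndex.

(** * Atoms: permutations as partitions into singletons *)

Section Atoms.

Variable n : nat.
Implicit Types (s : seq {set 'I_n}) (x y z w : osp n) (sigma : 'S_n).

Lemma atom_osp sigma : is_osp [seq [set sigma i] | i <- enum 'I_n].
Proof.
apply/and3P; split.
- by apply/mapP=> -[i _ e]; have := set11 (sigma i); rewrite -e inE.
- rewrite pairwise_map; have := enum_uniq 'I_n; rewrite uniq_pairwise.
  by apply: sub_pairwise => i j ij; rewrite /= disjoints1 inE (inj_eq perm_inj).
- apply/eqP/setP=> i; rewrite inE big_map bigcup_seq; apply/bigcupP.
  by exists (sigma^-1%g i); rewrite ?mem_enum // permKV set11.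
Qed.

Definition atom sigma : osp n := OSP (atom_osp sigma).

Lemma size_atom sigma : size (atom sigma) = n.
Proof. by rewrite size_map size_enum_ord. Qed.

Lemma idx_atom sigma i : idx (atom sigma) i = sigma^-1%g i.
Proof.
apply/eqP; rewrite -mem_nth_idx ?size_atom //.
rewrite (nth_map i) ?size_enum_ord // inE -{1}(permKV sigma i).
by rewrite (inj_eq perm_inj) nth_ord_enum.
Qed.

Lemma atom_inj : injective atom.
Proof.
move=> sigma tau e; apply: invg_inj; apply/permP=> i; apply: val_inj.
by rewrite /= -!idx_atom e.
Qed.

Lemma atom_act sigma a : osp_act (atom sigma) a = atom (sigma * a)%g.
Proof.
apply: val_inj => /=; rewrite /osp_act_blocks -map_comp; apply: eq_map => i /=.
by rewrite imset_set1 permM.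
Qed.

Lemma atom_of_size x : size x = n -> exists sigma, x = atom sigma.
Proof.
move=> xn; pose f i : 'I_n := cast_ord xn (Ordinal (idx_lt x i)).
have finj : injective f.
  suff /image_injP : #|image f predT| == #|{: 'I_n}| by move=> h i j /h->.
  apply/eqP/eq_card=> b; rewrite [RHS]inE; apply/imageP.
  have [|i ib] := @idx_onto _ x b; first by rewrite xn.
  by exists i => //; apply: val_inj; rewrite /= ib.
exists (perm finj)^-1%g; apply: osp_eq_idx => [|i]; first by rewrite size_atom.
by rewrite idx_atom invgK permE.
Qed.

(* Sort the entries by block, and inside each block by value. *)
Lemma atom_below x : exists sigma, osp_le (atom sigma) x.
Proof.
pose r (j i : 'I_n) := (idx x j < idx x i)%N || ((idx x j == idx x i) && (j < i)%N).
pose R i := [set j | r j i].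
have rR i : i \notin R i by rewrite inE /r !ltnn andbF.
have rS i j : r i j -> (#|R i| < #|R j|)%N.
  move=> ij; apply: proper_card; apply/properP; split; last first.
    by exists i; rewrite ?rR // inE.
  by apply/subsetP=> k; rewrite !inE; move: ij; rewrite /r; lia.
have Rn i : (#|R i| < n)%N.
  rewrite -[X in (_ < X)%N]card_ord -cardsT; apply: proper_card.
  by apply/properP; split; [apply: subsetT | exists i].
pose f i := Ordinal (Rn i).
have finj : injective f.
  move=> i j [e]; apply/eqP; case: eqVneq => // ij.
  have : r i j || r j i by move: ij; rewrite -val_eqE /r /=; lia.
  by case/orP=> /rS; rewrite e ltnn.
(* The inverse is taken because the position of [i] in [atom sigma] is given by the inverse of
   [sigma]. A cut of [x] consists of the first singletons, as many as it has elements. *)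
exists (perm finj)^-1%g; apply/osp_leP/subsetP=> _ /cutsP[m mx ->]; apply/cutsP.
exists #|cut x m|; first by rewrite size_atom -[X in (_ <= X)%N]card_ord max_card.
apply/setP=> i; rewrite !mem_cut idx_atom invgK permE /=; apply/idP/idP => im.
  apply: proper_card; apply/properP; split; last by exists i; rewrite ?rR // inE.
  by apply/subsetP=> j; rewrite !inE; move: im; rewrite /r; lia.
rewrite ltnNge; apply: contraTN im => im; rewrite -leqNgt; apply: subset_leq_card.
by apply/subsetP=> j; rewrite !inE; move: im; rewrite /r; lia.
Qed.

End Atoms.

(** * Rank and incidence numbers on [Omega n] *)

Section OmegaIncidence.

Variable n : nat.
Local Notation Om := (Omega n).
Implicit Types (s t : osp n) (x y z w : Om).

Definition orank x : nat := if x is Some s then n.+1 - size s else 0.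

(** At most one merge leads from [s] to [t], so the sum selects its sign and is 0 when there is
    none. *)
Definition merge_sign s t : rat :=
  \sum_(0 <= k < (size s).-1 | blocks t == merge_blocks k s) (-1) ^+ k.

Definition atom_sign t : rat := \sum_(sigma : 'S_n | t == atom sigma) (-1) ^+ sigma.

(* Incidence numbers: merging the blocks k and k + 1 has sign (-1)^k, as in a *)
(* simplex, and an atom has the sign of its permutation.                      *)
Definition incidence x y : rat :=
  match x, y with
  | Some s, Some t => merge_sign s t
  | None, Some t => atom_sign t
  | _, None => 0
  end.

Local Notation ocov := (cov orank).

Lemma merge_sign_mk s k (h : (k.+1 < size s)%N) : merge_sign s (mk h) = (-1) ^+ k.
Proof.
rewrite /merge_sign big_mkord (big_pred1 (Ordinal (_ : k < (size s).-1)%N)) //.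
  by move: h; lia.
move=> h0 l /=; apply/eqP/eqP => [e|->//]; apply: val_inj => /=.
have hl : (l.+1 < size s)%N by have := ltn_ord l; lia.
by apply/esym/(@mk_inj _ s k l h hl)/val_inj.
Qed.

Lemma atom_sign_atom sigma : atom_sign (atom sigma) = (-1) ^+ sigma.
Proof.
rewrite /atom_sign (big_pred1 sigma) // => tau.
by rewrite (inj_eq (@atom_inj n)) eq_sym.
Qed.

Lemma omega_leE s t : ((Some s : Om) <= Some t)%O = osp_le s t.
Proof. by []. Qed.

Lemma omega_ltE s t : ((Some s : Om) < Some t)%O = (s != t) && osp_le s t.
Proof. by rewrite lt_neqAle. Qed.

Lemma orank_lt x y : (x < y)%O -> (orank x < orank y)%N.
Proof.
case: x y => [s|] [t|] //; last by have := osp_size t; rewrite /orank; lia.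
rewrite omega_ltE => /andP[/eqP st /osp_le_size[//|]].
by have := osp_size s; rewrite /orank; lia.
Qed.

Lemma cov_Some s y : ocov (Some s) y -> exists t, y = Some t /\ merges_to s t.
Proof.
case: y => [t|]; last by case/andP.
rewrite /cov omega_ltE => /andP[/andP[st le] /eqP e]; exists t; split=> //.
apply: osp_le_merges => //; move: e; rewrite /orank.
by have := osp_size s; have := osp_size t; lia.
Qed.

Lemma cov_Some_mk s k (h : (k.+1 < size s)%N) : ocov (Some s) (Some (mk h)).
Proof.
have e := size_mk h; have le : osp_le s (mk h) := connect1 (merges_to_mk h).
rewrite /cov omega_ltE le andbT.
rewrite /orank e; apply/andP; split.
  by apply/eqP=> /(congr1 (fun u : osp n => size u)); rewrite e; move: (h); lia.
by have := osp_size s; move: (h); lia.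
Qed.

Lemma cov_SomeE s t : ocov (Some s) (Some t) = merges_to s t.
Proof.
apply/idP/idP; first by case/cov_Some=> _ [[<-]].
by case/merges_to_mkP=> k [h ->]; apply: cov_Some_mk.
Qed.

Lemma cov_None y : ocov None y -> exists sigma, y = Some (atom sigma).
Proof.
case: y => [t|]; last by case/andP.
case/andP=> _ /eqP; rewrite /orank => e.
have [|sigma ->] := @atom_of_size n t; first by have := osp_size t; lia.
by exists sigma.
Qed.

Lemma cov_None_atom sigma : ocov None (Some (atom sigma)).
Proof. by rewrite /cov /orank size_atom subSnn. Qed.

Lemma cov_omega_ex x y : (x < y)%O -> exists2 z, ocov x z & (z <= y)%O.
Proof.
case: x y => [s|] [t|] //.
  rewrite omega_ltE => /andP[st /osp_le_step/(_ st)[k [h le]]].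
  by exists (Some (mk h)) => //; apply: cov_Some_mk.
move=> _; have [sigma le] := atom_below t.
by exists (Some (atom sigma)) => //; apply: cov_None_atom.
Qed.

Lemma incidence_neq0 x y : ocov x y -> incidence x y != 0.
Proof.
case: x => [s /cov_Some[_ [-> /merges_to_mkP[k [h ->]]]]|/cov_None[sigma ->]] /=.
  by rewrite merge_sign_mk signr_eq0.
by rewrite atom_sign_atom signr_eq0.
Qed.

Lemma omega_act_rank (a : 'S_n) x : orank (omega_act n x a) = orank x.
Proof. by case: x => //= s; rewrite size_map. Qed.

Lemma osp_act_inj a : injective (fun s : osp n => osp_act s a).
Proof. by move=> s t /(congr1 (fun u => osp_act u a^-1%g)); rewrite -!osp_actM mulgV !osp_act1. Qed.

Lemma incidence_act a x y : incidence (omega_act n x a) (omega_act n y a) =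
  (if x == None then (-1) ^+ a else 1) * incidence x y.
Proof.
case: x y => [s|] [t|] /=; rewrite ?mulr0 ?mul1r //.
  rewrite /merge_sign /= size_map big_nat_cond [RHS]big_nat_cond.
  apply: eq_bigl => k; case: ltnP => //= ks; rewrite -osp_act_merge; last by move: ks; lia.
  rewrite (inj_eq (inj_map _)) //; exact/imset_inj/perm_inj.
rewrite /atom_sign (reindex_inj (mulIg a)) /= mulr_sumr; apply: eq_big => sigma.
  by rewrite -atom_act (inj_eq (@osp_act_inj a)).
by move=> _; rewrite odd_permM signr_addb mulrC.
Qed.

End OmegaIncidence.

Lemma sum_pred2 (I : finType) (V : nmodType) (a b : I) (F : I -> V) : a != b ->
  \sum_(i | (i == a) || (i == b)) F i = F a + F b.
Proof.
move=> ab; rewrite (bigD1 a) ?eqxx //=; congr (_ + _); apply: big_pred1 => i /=.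
by case: (eqVneq i a) => [->|]; rewrite ?andbT ?andbF // (negbTE ab).
Qed.

(** Without an adjacent descent [pi] is increasing, so [i <= pi i] for all [i]; both sides have the
    same sum, which forces equality. *)
Lemma perm_descent n (pi : 'S_n) : pi != 1%g ->
  exists i j : 'I_n, j = i.+1 :> nat /\ (pi j < pi i)%N.
Proof.
case: (boolP [exists i : 'I_n, exists j : 'I_n, (j == i.+1 :> nat) && (pi j < pi i)%N]).
  by move=> /existsP[i /existsP[j /andP[/eqP]]]; exists i, j.
move=> none /eqP[]; have asc (i j : 'I_n) : j = i.+1 :> nat -> (pi i < pi j)%N.
  move=> ji; rewrite ltn_neqAle; apply/andP; split.
    by rewrite val_eqE (inj_eq perm_inj) -val_eqE /= ji; lia.
  rewrite leqNgt; apply: contra none => h; apply/existsP; exists i.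
  by apply/existsP; exists j; rewrite ji eqxx.
have ge m (mn : (m < n)%N) : (m <= pi (Ordinal mn))%N.
  elim: m mn => // m IHm mn; apply: leq_ltn_trans (IHm (ltnW mn)) _.
  exact: asc.
have ge' (i : 'I_n) : (i <= pi i)%N by case: i => m mn; apply: ge.
have : (\sum_(i < n) (pi i - i) = 0)%N.
  rewrite sumnB // [X in (X - _)%N](_ : _ = \sum_(i < n) i)%N ?subnn //.
  by rewrite [RHS](reindex_inj (@perm_inj _ pi)).
move/eqP; rewrite sum_nat_eq0 => /forallP eq0; apply/permP=> i; rewrite perm1.
by apply: val_inj; have := eq0 i; have := ge' i; rewrite /=; lia.
Qed.

(* Measures how far pi is from 1 under exchanging adjacent descents. *)
Definition perm_weight n (pi : 'S_n) : nat := \sum_(i < n) (n - i) * pi i.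

Lemma perm_weight_tperm n (pi : 'S_n) (i j : 'I_n) : j = i.+1 :> nat ->
  (pi j < pi i)%N -> (perm_weight (tperm i j * pi)%g < perm_weight pi)%N.
Proof.
move=> ji desc; rewrite /perm_weight.
have ij : j != i by rewrite -val_eqE /= ji; lia.
rewrite (bigD1 i) //= (bigD1 j) //= [X in (_ < X)%N](bigD1 i) //=.
rewrite [X in (_ < _ + X)%N](bigD1 j) //= !permM tpermL tpermR.
rewrite [X in (_ + (_ + X) < _)%N](eq_bigr (fun m : 'I_n => (n - m) * pi m)%N); last first.
  by move=> m /andP[mi mj]; rewrite permM tpermD // eq_sym.
move: (\sum_(m < n | _) _)%N => R.
rewrite (_ : (n - i = (n - j).+1)%N); last by have := ltn_ord j; rewrite ji; lia.
by rewrite !mulSn; move: ((n - j) * _)%N ((n - j) * _)%N => A B; lia.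
Qed.

(** * Diamond and exactness relations in [Omega n] *)

Section OmegaDiamond.

Variable n : nat.
Local Notation Om := (Omega n).
Implicit Types (s t u : osp n) (x y z w : Om).
Local Notation ocov := (cov (@orank n)).

Lemma two_merges s t u : merges_to s t -> merges_to t u ->
  exists k l (kl : (k < l)%N) (hk : (k.+1 < size s)%N) (hl : (l.+1 < size s)%N),
    u = mk2 kl hk hl.
Proof.
move=> /merges_to_mkP[k [hk ->]] /merges_to_mkP[l [hl ->]].
have hl' := hl; rewrite size_mk in hl'.
case: (leqP k l) => kl.
  have hl1 : (l.+2 < size s)%N by move: (hl'); lia.
  have kl1 : (k < l.+1)%N by [].
  exists k, l.+1, kl1, hk, hl1; rewrite (mk2E kl1 hk hl1).
  exact: val_inj.
have hl1 : (l.+1 < size s)%N by move: (hl'); lia.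
by exists l, k, kl, hl1, hk; apply: val_inj.
Qed.

Section TwoMerges.

Variables (s : osp n) (k l : nat) (kl : (k < l)%N).
Variables (hk : (k.+1 < size s)%N) (hl : (l.+1 < size s)%N).

Lemma sum_between_mk2 (a : Om -> rat) :
  \sum_(z | ocov (Some s) z && ocov z (Some (mk2 kl hk hl)))
     a z * incidence z (Some (mk2 kl hk hl)) =
  a (Some (mk hk)) * (-1) ^+ l.-1 + a (Some (mk hl)) * (-1) ^+ k.
Proof.
rewrite (eq_bigl (fun z => (z == Some (mk hk)) || (z == Some (mk hl)))).
  rewrite sum_pred2; last first.
    apply/eqP=> -[e]; have kle : k = l.
      by apply: (@mk_inj _ s k l hk hl); apply: val_inj.
    by move: kl; rewrite kle ltnn.
  by congr (_ * _ + _ * _); rewrite /= ?merge_sign_mk // (mk2E kl hk hl) merge_sign_mk.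
case=> [t|]; last by apply/negbTE/negP=> /andP[/cov_Some[t []]].
by rewrite !cov_SomeE between_mk2.
Qed.

End TwoMerges.

Lemma idx_act s a i : idx (osp_act s a) i = idx s (a^-1%g i).
Proof.
rewrite /idx /= /osp_act_blocks find_map; apply: eq_find => B /=.
by rewrite -{1}(permKV a i) mem_imset //; apply: perm_inj.
Qed.

Lemma idx_collision s : (size s < n)%N -> exists i j, i != j /\ idx s i = idx s j.
Proof.
move=> sn; pose f i := Ordinal (idx_lt s i).
have : ~~ injectiveb f.
  by apply: contraL sn => /injectiveP/leq_card; rewrite !card_ord leqNgt.
by case/injectivePn=> i [j ij [e]]; exists i, j.
Qed.

Lemma osp_act_tperm s i j : idx s i = idx s j -> osp_act s (tperm i j) = s.
Proof.
move=> ij; apply: osp_eq_idx => [|k]; first by rewrite size_map.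
by rewrite idx_act tpermV; case: tpermP => // ->.
Qed.

(** Above a partition, the two orders of merging at [k < l] have signs $(-1)^{k+l-1}$ and
    $(-1)^{k+l}$. Above the minimum, some block of [w] has two entries; their transposition fixes
    [w] and reverses the signs of the atoms, so the sum equals its negative. *)
Lemma incidence_diamond x w : orank w = (orank x).+2 ->
  \sum_(z | ocov x z && ocov z w) incidence x z * incidence z w = 0.
Proof.
case: w => [u|//] rw; case: x rw => [s|] rw.
  case: (pickP [pred z | ocov (Some s) z && ocov z (Some u)]); last exact: big_pred0.
  move=> z /andP[/cov_Some[t [-> st]]]; rewrite cov_SomeE => tu.
  have [k [l [kl [hk [hl ->]]]]] := two_merges st tu.
  rewrite (sum_between_mk2 kl hk hl) /= !merge_sign_mk.
  by rewrite -{2}(prednK (leq_ltn_trans (leq0n k) kl)) exprS; ring.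
have un : (size u < n)%N by move: rw; rewrite /orank; lia.
have [i [j [ij e]]] := idx_collision un; set S := \sum_(z | _) _.
apply/eqP; rewrite -Num.Theory.eqNr; apply/eqP; rewrite -mulN1r.
have -> : -1 = (-1) ^+ tperm i j :> rat by rewrite odd_tperm ij.
have uE : omega_act n (Some u) (tperm i j) = Some u by rewrite /= osp_act_tperm.
rewrite {2}/S (reindex_inj (act_inj (omega_act n) (tperm i j))) /=.
rewrite /S mulr_sumr.
apply: eq_big => [z|z /andP[/cov_None[sigma ->] _]].
  have E y1 y2 : ocov (omega_act n y1 (tperm i j)) (omega_act n y2 (tperm i j)) = ocov y1 y2.
    by rewrite (cov_act (@omega_act_mono n) (@omega_act_rank n)).
  by have := E z (Some u); have := E None z; rewrite uE => <- <-.
rewrite mulrA; congr (_ * _).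
  exact: (esym (incidence_act (tperm i j) None (Some (atom sigma)))).
by have := incidence_act (tperm i j) (Some (atom sigma)) (Some u); rewrite uE mul1r.
Qed.

(** Any two merges of [s] below [y] have their common merge below [y] too, and its diamond relation
    says that [a] times the merge sign agrees on the two. *)
Lemma exact_above_Some s y (a : Om -> rat) : ((Some s : Om) < y)%O ->
  (orank (Some s) + 2 <= orank y)%N ->
  (forall w, (w <= y)%O -> orank w = (orank (Some s)).+2 ->
     \sum_(z | ocov (Some s) z && ocov z w) a z * incidence z w = 0) ->
  exists b, forall z, ocov (Some s) z -> (z <= y)%O -> a z = b * incidence (Some s) z.
Proof.
case: y => [t|//] st rst eq0.
have key k l (kl : (k < l)%N) (hk : (k.+1 < size s)%N) (hl : (l.+1 < size s)%N) :
    osp_le (mk hk) t -> osp_le (mk hl) t ->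
    a (Some (mk hl)) * (-1) ^+ l = a (Some (mk hk)) * (-1) ^+ k.
  move=> /osp_leP kt /osp_leP lt.
  have := eq0 (Some (mk2 kl hk hl)); rewrite sum_between_mk2 => E.
  have {}E : a (Some (mk hk)) * (-1) ^+ l.-1 + a (Some (mk hl)) * (-1) ^+ k = 0.
    apply: E; last first.
      by rewrite /orank; have := size_mk2 kl hk hl; have := osp_size s; lia.
    rewrite omega_leE; apply/osp_leP; rewrite cuts_mk2 !subsetD1.
    move: kt lt; rewrite !cuts_mk !subsetD1 => /andP[-> ->] /andP[_ ->].
    by [].
  have lE : (-1) ^+ l = - (-1) ^+ l.-1 :> rat.
    by rewrite -{1}(prednK (leq_ltn_trans (leq0n k) kl)) exprS mulN1r.
  have sq m : (-1) ^+ m * (-1) ^+ m = 1 :> rat by rewrite -expr2 sqrr_sign.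
  have alg (A B c d : rat) : c * c = 1 -> d * d = 1 -> A * c = - (B * d) ->
      B * - c = A * d.
    move=> cc dd e; transitivity (- (B * d) * (c * d)).
      by rewrite -[LHS]mulr1 -dd; ring.
    by rewrite -e -[RHS]mulr1 -cc; ring.
  by rewrite lE; apply: alg => //; apply/eqP; rewrite -addr_eq0 E.
have [z0 /cov_Some[_ [-> /merges_to_mkP[k [hk ->]]]] kt] := cov_omega_ex st.
exists (a (Some (mk hk)) * (-1) ^+ k) => z.
case/cov_Some=> _ [-> /merges_to_mkP[l [hl ->]]] lt; rewrite /= merge_sign_mk.
have -> : a (Some (mk hk)) * (-1) ^+ k = a (Some (mk hl)) * (-1) ^+ l.
  case: (ltngtP k l) => kl; last by subst l; congr (a (Some _) * _); apply: val_inj.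
    exact/esym/key.
  exact: key.
by rewrite -mulrA -expr2 sqrr_sign mulr1.
Qed.

Section AdjacentAtoms.

Variables (sigma : 'S_n) (i j : 'I_n) (ji : j = i.+1 :> nat).

Lemma adjacent_merge_lt (tau : 'S_n) : (i.+1 < size (atom tau))%N.
Proof using ji. by rewrite size_atom -ji. Qed.

Local Notation w := (mk (adjacent_merge_lt sigma)).

Lemma adjacent_mergeE : mk (adjacent_merge_lt (tperm i j * sigma)%g) = w.
Proof.
apply: osp_eq_idx => [|p]; first by rewrite !size_mk !size_atom.
rewrite !idx_merge ?adjacent_merge_lt // !idx_atom invMg permM tpermV.
by case: tpermP => [->|->|//]; rewrite ji; lia.
Qed.

(** Comparing positions in the merged partition shows that [sigma * tau^-1] respects the collapse of
    two neighbors, so it is the identity or the exchange of [i] and [j]. *)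
Lemma atom_below_adjacent_merge (tau : 'S_n) : merges_to (atom tau) w ->
  tau = sigma \/ tau = (tperm i j * sigma)%g.
Proof.
case/merges_to_mkP=> k [hk] /(congr1 (fun t : osp n => idx t)) e.
pose u : 'S_n := (sigma * tau^-1)%g.
have E (m : 'I_n) : (m - (i < m) = u m - (k < u m))%N.
  have := congr1 (fun f => f (sigma m)) e.
  by rewrite /= !idx_merge ?adjacent_merge_lt // !idx_atom permK permM.
have kn : (k.+1 < n)%N by move: (hk); rewrite size_atom.
have [m1 m1E] : exists m, u m = Ordinal (ltnW kn) by exists (u^-1%g (Ordinal (ltnW kn))); rewrite permKV.
have [m2 m2E] : exists m, u m = Ordinal kn by exists (u^-1%g (Ordinal kn)); rewrite permKV.
have m12 : m1 != m2 :> nat.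
  rewrite val_eqE; apply: contraTneq (ltnSn k) => em; rewrite em m2E in m1E.
  by case: m1E; lia.
(* The two positions sent to [k] and [k + 1] become equal after merging, so they are [i] and
   [i + 1], with common collapsed value [i]. *)
have ki : k = i.
  have := E m1; have := E m2; rewrite m1E m2E /=.
  by move: m12; lia.
have tauE : tau = (u^-1 * sigma)%g by rewrite invMg invgK mulgKV.
have ufix (m : 'I_n) : m != i -> m != j -> u m = m.
  rewrite -!val_eqE /= ji => mi mj; apply: val_inj => /=.
  by have := E m; rewrite ki; lia.
have ui : u i = i \/ u i = j.
  have := E i; rewrite ki => Ei.
  case: (ltngtP (u i) i) => h; first by lia.
    by right; apply: val_inj; rewrite /= ji; lia.
  by left; apply: val_inj.
have uj : u j = i \/ u j = j.
  have := E j; rewrite ki ji => Ej.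
  case: (ltngtP (u j) i) => h; first by lia.
    by right; apply: val_inj; rewrite /= ji; lia.
  by left; apply: val_inj.
have ij : i != j by rewrite -val_eqE /= ji; lia.
have uinj := @perm_inj _ u.
case: ui => ui; [left | right].
  suff u1 : u = 1%g by rewrite tauE u1 invg1 mul1g.
  apply/permP=> m; rewrite perm1.
  have [->//|mi] := eqVneq m i; have [->|mj] := eqVneq m j; last exact: ufix.
  by case: uj => // uj; case/eqP: ij; apply: uinj; rewrite ui uj.
suff u1 : u = tperm i j by rewrite tauE u1 tpermV.
apply/permP=> m; case: tpermP => [->//|->|/eqP mi /eqP mj]; last exact: ufix.
by case: uj => // uj; case/eqP: ij; apply: uinj; rewrite ui uj.
Qed.

Lemma sum_adjacent_merge (a : Om -> rat) :
  \sum_(z | ocov None z && ocov z (Some w)) a z * incidence z (Some w) =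
  (a (Some (atom sigma)) + a (Some (atom (tperm i j * sigma)))) * (-1) ^+ i.
Proof.
rewrite (eq_bigl (fun z => (z == Some (atom sigma)) || (z == Some (atom (tperm i j * sigma))))).
  rewrite sum_pred2.
    have e2 : merge_sign (atom (tperm i j * sigma)%g) w = (-1) ^+ i.
      by rewrite -adjacent_mergeE merge_sign_mk.
    have e1 : merge_sign (atom sigma) w = (-1) ^+ i by rewrite merge_sign_mk.
    by rewrite [incidence _ _]e1 [incidence _ _]e2 mulrDl.
  apply/eqP=> -[e]; have : atom sigma = atom (tperm i j * sigma)%g by apply: val_inj.
  move=> /atom_inj/(congr1 (fun rho => rho * sigma^-1)%g).
  rewrite mulgV mulgK => /permP/(_ i); rewrite tpermL perm1 => /(congr1 val) /=.
  by rewrite ji; lia.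
move=> z; apply/andP/orP.
  case=> /cov_None[tau ->]; rewrite cov_SomeE.
  by case/atom_below_adjacent_merge=> ->; [left | right].
case=> /eqP->; rewrite cov_None_atom cov_SomeE; split=> //; first exact: merges_to_mk.
by rewrite -adjacent_mergeE merges_to_mk.
Qed.

End AdjacentAtoms.

(** By the diamond relation an adjacent exchange changes the sign of [a], so [a] times the sign of
    the atom is unchanged. Exchanging descents relative to a fixed atom [tau] below [t] leads every
    atom below [t] to [tau] without leaving that set. *)
Lemma exact_above_None t (a : Om -> rat) :
  (forall w, (w <= (Some t : Om))%O -> orank w = 2%N ->
     \sum_(z | ocov None z && ocov z w) a z * incidence z w = 0) ->
  exists b, forall z, ocov None z -> (z <= (Some t : Om))%O -> a z = b * incidence None z.
Proof.
move=> eq0; pose b sigma := a (Some (atom sigma)) * (-1) ^+ odd_perm sigma.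
have [tau tau_t] := atom_below t.
suff bE sigma : osp_le (atom sigma) t -> b sigma = b tau.
  exists (b tau) => z /cov_None[sigma ->] /bE <-.
  by rewrite /= atom_sign_atom /b -mulrA -expr2 sqrr_sign mulr1.
have [m] := ubnP (perm_weight (sigma * tau^-1)%g); elim: m sigma => // m IHm sigma.
rewrite ltnS => wm sigma_t.
have [e|/perm_descent[i [j [ji desc]]]] := eqVneq (sigma * tau^-1)%g 1%g.
  by congr b; apply/eqP; rewrite eq_mulgV1 e.
pose w := mk (adjacent_merge_lt ji sigma).
have w_t : osp_le w t.
  apply/osp_leP; rewrite cuts_mk subsetD1 (osp_leP _ _ sigma_t) /=.
  (* A cut of [t] between [sigma i] and [sigma j] would also be a cut of [tau], so [tau] would list
     [sigma i] first; the descent says the opposite. *)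
  apply/negP=> /(subsetP (osp_leP _ _ tau_t)) /cutsP[l _ /setP e].
  have := e (sigma i); have := e (sigma j); rewrite !mem_cut !idx_atom !permK.
  by move: desc; rewrite !permM ji; lia.
have w2 : orank (Some w) = 2%N.
  by rewrite /orank size_mk size_atom; have := ltn_ord j; rewrite ji; lia.
have := eq0 (Some w) w_t w2; rewrite sum_adjacent_merge => /eqP.
rewrite mulf_eq0 signr_eq0 orbF addr_eq0 => /eqP aE.
rewrite -(IHm (tperm i j * sigma)%g).
- rewrite /b aE odd_permM odd_tperm; have -> : i != j by rewrite -val_eqE /= ji; lia.
  by rewrite signr_addb expr1 mulN1r mulrN mulNr.
- by rewrite -mulgA; apply: leq_trans (perm_weight_tperm ji desc) wm.
apply: connect_trans w_t; rewrite /w -adjacent_mergeE.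
exact/connect1/merges_to_mk.
Qed.

Lemma incidence_exact x y (a : Om -> rat) : (x < y)%O -> (orank x + 2 <= orank y)%N ->
  (forall w, (w <= y)%O -> orank w = (orank x).+2 ->
     \sum_(z | ocov x z && ocov z w) a z * incidence z w = 0) ->
  exists b, forall z, ocov x z -> (z <= y)%O -> a z = b * incidence x z.
Proof.
case: x => [s|]; first exact: exact_above_Some.
by case: y => [t|//] _ _; apply: exact_above_None.
Qed.

End OmegaDiamond.

(** * Whitney homology as signed permutation modules *)

Notation sized_osp n k := {s : osp n | size s == k}.

Section OspsOfSize.

Variables n k : nat.

Lemma sized_osp_actP (s : sized_osp n k) (a : 'S_n) : size (osp_act (val s) a) == k.
Proof. by rewrite size_map (valP s). Qed.

Definition sized_osp_act_fun (s : sized_osp n k) a : sized_osp n k := Sub (osp_act (val s) a) (sized_osp_actP s a).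

Lemma sized_osp_act1 : sized_osp_act_fun^~ 1%g =1 id.
Proof. by move=> s; apply: val_inj; rewrite /= osp_act1. Qed.

Lemma sized_osp_actM s : act_morph sized_osp_act_fun s.
Proof. by move=> a b; apply: val_inj; rewrite /= osp_actM. Qed.

Definition sized_osp_act : {action 'S_n &-> sized_osp n k} :=
  TotalAction sized_osp_act1 sized_osp_actM.

End OspsOfSize.

Section SignTwist.

Variables (n : nat) (b : bool).

Definition sgn_pow (a : 'S_n) : rat := (-1) ^+ (b && a).

Lemma sgn_pow1 : sgn_pow 1%g = 1.
Proof. by rewrite /sgn_pow odd_perm1 andbF. Qed.

Lemma sgn_powM : {morph sgn_pow : a c / (a * c)%g >-> a * c}.
Proof. by move=> a c; rewrite /sgn_pow odd_permM; case: b; rewrite ?signr_addb ?mulr1. Qed.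

Definition osp_module k : mx_representation rat [set: 'S_n] #|{: sized_osp n k}| :=
  twisted_perm (sized_osp_act n k) sgn_pow1 sgn_powM.

End SignTwist.

(** * Identification of the Whitney modules *)

Section OmegaModules.

Variable n : nat.
Local Notation Om := (Omega n).

(** The form shared by the nontrivial cases: intervals indexed equivariantly by partitions with [k]
    blocks, whose lower ends are either all the minimum or all proper. The latter alternative,
    recorded by [b], decides the sign twist. *)
Lemma omega_homology_sum b (k r : nat) j (T : {set Om * Om})
    (T_act : forall a p, p \in T -> (omega_act n p.1 a, omega_act n p.2 a) \in T)
    (phi : sized_osp n k -> Om * Om) :
  injective phi -> phi @: setT = T ->
  (forall a s, phi (sized_osp_act n k s a) =
     (omega_act n (phi s).1 a, omega_act n (phi s).2 a)) ->
  (forall s, ((phi s).1 < (phi s).2)%O) ->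
  (forall s, orank (phi s).2 = (orank (phi s).1 + r.+1)%N) ->
  (forall s, ((phi s).1 == None) = b) -> j + 1 = r%:Z ->
  mx_rsim (osp_module n b k) (homology_sum (@omega_act_mono n) j T_act).
Proof.
move=> phi_inj phi_im phi_act phi_lt phi_rk phi_b jr.
have TP p : p \in T -> exists s, p = phi s by rewrite -phi_im => /imsetP[s _ ->]; exists s.
apply: (homology_sum_twisted_perm (@omega_act_mono n) T_act phi_inj phi_im phi_act
  (v := fun p => fcyc_row (@orank n) (@incidence n) r p.1 p.2)).
  move=> p /TP[s ->]; apply: fcyc_generator => //.
  - exact: orank_lt.
  - exact: cov_omega_ex.
  - exact: incidence_neq0.
  - exact: incidence_diamond.
  - exact: incidence_exact.
move=> a p /TP[s ->].
rewrite (fcyc_row_act (mu := fun (x : Om) (a : 'S_n) => if x == None then (-1) ^+ a else 1)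
  (@omega_act_mono n)) //.
- by rewrite phi_b /sgn_pow; case: (b).
- exact: omega_act_rank.
- by move=> a' x z _; apply: incidence_act.
- by move=> a' [x|] [z|] //.
- by move=> a' x; case: ifP => _; rewrite ?mulr1 // -expr2 sqrr_sign.
Qed.

Hypothesis n_gt0 : (0 < n)%N.

Lemma size_osp_top : size (osp_top n) = 1%N.
Proof.
rewrite /= /osp_top_blocks /=; have -> // : [set: 'I_n] != set0.
by apply/set0Pn; exists (Ordinal n_gt0).
Qed.

Lemma osp_size_gt0 (s : osp n) : (0 < size s)%N.
Proof. exact: leq_ltn_trans (leq0n _) (idx_lt s (Ordinal n_gt0)). Qed.

Lemma orank_top : orank (\top%O : Om) = n.
Proof. by rewrite /orank /= size_osp_top subSS subn0. Qed.

Lemma rk_omega (x : Om) : rk x = orank x.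
Proof. by apply: rk_rho => //; [apply: orank_lt | apply: cov_omega_ex]. Qed.

Lemma crk_omega (x : Om) : crk x = (n - orank x)%N.
Proof. by rewrite /crk !rk_omega orank_top. Qed.

Lemma omega_graded : graded_of_rank Om n.
Proof.
have := @graded_rho _ Om (@orank n) (@orank_lt n) (@cov_omega_ex n) erefl.
by rewrite orank_top.
Qed.

Lemma sized_osp1 (s : osp n) : size s = 1%N -> s = osp_top n.
Proof.
by move=> s1; case: (osp_le_size (osp_le_top s)) => //; rewrite s1 size_osp_top.
Qed.

Lemma osp_module_triv : mx_rsim (osp_module n false 1) (triv_module _).
Proof.
pose s0 : sized_osp n 1 := Sub (osp_top n) (introT eqP size_osp_top).
have sE (s : sized_osp n 1) : s = s0.
  by apply: val_inj; apply: sized_osp1; apply/eqP; apply: (valP s).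
have card1 : #|{: sized_osp n 1}| = 1%N.
  by rewrite (eq_card (B := pred1 s0)) ?card1 // => s; rewrite !inE [s]sE eqxx.
exists (const_mx 1) => // [|a _].
  rewrite /row_free card1 eqn_leq rank_leq_col lt0n mxrank_eq0.
  apply/eqP=> /matrixP/(_ 0 0); rewrite !mxE => /eqP.
  by rewrite oner_eq0.
rewrite /= mulmx1 /sgn_pow scale1r; apply/row_matrixP=> i.
rewrite row_mul rowK; have -> : basis_vec (sized_osp_act n 1 (enum_val i) a) = basis_vec s0.
  by rewrite [sized_osp_act _ _ _ _]sE.
by rewrite -rowE !row_const.
Qed.

Lemma dualWH_osp_module k : (k < n)%N -> mx_rsim (osp_module n false k.+1) (dualWH_Omega n k).
Proof.
case: k => [|k] kn; first exact: osp_module_triv.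
apply: (@omega_homology_sum false k.+2 k _ _ _ (fun s => (Some (val s), \top%O))).
- by move=> s t /(congr1 (fun p : Om * Om => odflt (val s) p.1)); apply: val_inj.
- apply/setP=> p; rewrite inE crk_omega; apply/imsetP/andP.
    case=> s _ ->; split=> //=; have := osp_size (val s).
    by rewrite /orank (eqP (valP s)); lia.
  case: p => [[s|] x] /= [/eqP->]; last by rewrite subn0; lia.
  rewrite /orank => sk; have sk2 : size s == k.+2 by have := osp_size s; move: sk; lia.
  by exists (Sub s sk2).
- by move=> a s; rewrite (top_act (@omega_act_mono n)).
- move=> s; rewrite lt_neqAle lex1 andbT; apply/eqP=> /(congr1 (@orank n)).
  by rewrite orank_top /= (eqP (valP s)); lia.
- by move=> s; rewrite orank_top /= (eqP (valP s)); lia.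
- by [].
- by lia.
Qed.

Lemma sum_lower_osp_module k r j T T_act : (0 < k)%N -> (k + r = n)%N -> j + 1 = r%:Z ->
  T = (fun s : sized_osp n k => (None, Some (val s))) @: setT ->
  mx_rsim (osp_module n true k) (@homology_sum _ Om _ _ (@omega_act_mono n) T j T_act).
Proof.
move=> k0 kr jr TE; apply: (@omega_homology_sum true k r _ _ _ (fun s => (None, Some (val s)))) => //.
- by move=> s t /(congr1 (fun p : Om * Om => odflt (val s) p.2)); apply: val_inj.
- by move=> s /=; rewrite (eqP (valP s)); lia.
Qed.

Lemma WH_osp_module k : (k < n)%N -> mx_rsim (osp_module n true k.+1) (WH_Omega n (n - k)).
Proof.
move=> kn; have [r rE] : exists r, (n - k = r.+1)%N by exists (n - k).-1; lia.
rewrite rE; apply: (@sum_lower_osp_module k.+1 r) => //; [lia | lia |].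
apply/setP=> p; rewrite inE rk_omega; apply/andP/imsetP.
  case: p => x [s|] /= [/eqP->] // => e.
  have sk : size s == k.+1 by have := osp_size s; move: e; lia.
  by exists (Sub s sk).
by case=> s _ -> /=; rewrite (eqP (valP s)); split=> //; lia.
Qed.

Lemma dualWH_top_osp_module : mx_rsim (osp_module n true 1) (dualWH_Omega n n).
Proof.
(* The degree is generalized so that the match defining the dual Whitney module can be resolved;
   degree 0 is excluded since [n > 0]. *)
have E m : m = n -> mx_rsim (osp_module n true 1) (dualWH_Omega n m).
  case: m => [|r] rn; first by move: n_gt0; rewrite -rn.
  apply: (@sum_lower_osp_module 1 r) => //; [lia |].
  apply/setP=> p; rewrite inE crk_omega; apply/andP/imsetP.
    case: p => [[s|] x] /= [/eqP-> e].
      by have := osp_size_gt0 s; have := osp_size s; move: e; lia.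
    by exists (Sub (osp_top n) (introT eqP size_osp_top)).
  case=> s _ -> /=; split; last by rewrite subn0 rn.
  by apply/eqP; rewrite (sized_osp1 (eqP (valP s))).
exact: E.
Qed.

Lemma WH0_osp_module : mx_rsim (osp_module n false 1) (WH_Omega n 0).
Proof. exact: osp_module_triv. Qed.

End OmegaModules.

(** * Tensoring with the sign *)

Lemma mx_rsim_scale (gT : finGroupType) (c : gT -> rat) m1 m2 m
    (V : mx_representation rat [set: gT] m1) (U U' : mx_representation rat [set: gT] m2)
    (W : mx_representation rat [set: gT] m) (e : m1 = m) :
  (forall a, W a = castmx (e, e) (c a *: V a)) -> (forall a, U' a = c a *: U a) ->
  mx_rsim V U -> mx_rsim W U'.
Proof.
case: _ / e W => W WE UE [B m12 Bfree VU]; exists B => // a aG.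
by rewrite WE UE castmx_id -scalemxAl VU // scalemxAr.
Qed.

(** Tensoring with a one-dimensional module only scales the matrices. The cast in [mx_rsim_scale] is
    there for the dimension [1 * m] of the tensor product. *)
Lemma sgn_osp_module n b k m (V : mx_representation rat [set: 'S_n] m) :
  mx_rsim V (osp_module n b k) ->
  mx_rsim (prod_repr (sgn_module n) V) (osp_module n (~~ b) k).
Proof.
apply: (@mx_rsim_scale _ (fun a : 'S_n => (-1) ^+ a) _ _ _ _ _ _ _ (esym (mul1n m))).
  by move=> a; rewrite prod_repr_lin ?inE // [sgn_module n a _ _]mxE.
move=> a; rewrite /= scalerA; congr (_ *: _); rewrite /sgn_pow.
by case: b; case: odd_perm; rewrite /= ?mulr1 ?mulN1r ?opprK.
Qed.

(** * Frobenius characteristics *)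

Section Fibers.

Variables (n : nat) (Y : finType).
Implicit Types (g : {ffun 'I_n -> Y}) (w : 'S_n).

Definition pstab g : {set 'S_n} := [set w : 'S_n | [forall l, g (w l) == g l]].

Definition fiber g (y : Y) : nat := #|[set l | g l == y]|.

Lemma pstabP g w : reflect (forall l, g (w l) = g l) (w \in pstab g).
Proof. by rewrite inE; apply: 'forall_eqP. Qed.

(* A transposition fixing g reverses the sign. *)
Lemma sum_sgn_pstab b g :
  \sum_(w in pstab g) sgn_pow b w = (if b && ~~ injectiveb g then 0 else #|pstab g|)%:R.
Proof.
case: b => /=; last by rewrite (eq_bigr (fun=> 1)) ?sumr_const.
case: injectiveP => [ginj|/injectiveP/injectivePn[i [j ij gij]]] /=.
  rewrite (eq_bigr (fun=> 1)) ?sumr_const // => w /pstabP gw.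
  have -> : w = 1%g by apply/permP=> l; rewrite perm1; apply: ginj.
  exact: sgn_pow1.
set S := \sum_(w in _) _; apply/eqP; rewrite -Num.Theory.eqNr; apply/eqP.
rewrite {2}/S (reindex_inj (mulgI (tperm i j))) /= /S -sumrN.
apply: eq_big => w.
  apply/pstabP/pstabP => gw l; first by rewrite permM gw; case: tpermP => // ->.
  by have := gw (tperm i j l); rewrite permM tpermK => ->; case: tpermP => // ->.
by rewrite /sgn_pow /= odd_permM odd_tperm ij signr_addb expr1 mulN1r.
Qed.

Lemma sum_fiber g : (\sum_y fiber g y = n)%N.
Proof.
rewrite -[RHS]card_ord -sum1_card (partition_big g predT) //=.
by apply: eq_bigr => y _; rewrite sum1dep_card.
Qed.

Lemma fiber_perm g w y : fiber (finfun (g \o w)) y = fiber g y.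
Proof.
rewrite /fiber -(card_imset _ (@perm_inj _ w)); apply: eq_card => l.
rewrite inE; apply/imsetP/eqP => [[m + ->]|gl].
  by rewrite inE ffunE => /eqP.
by exists (w^-1%g l); rewrite ?inE ?ffunE /= permKV ?gl.
Qed.

Lemma count_mem_ffun g y : count_mem y [tuple g l | l < n] = fiber g y.
Proof.
rewrite /= count_map /fiber cardE [in RHS]/enum_mem size_filter enumT.
by apply: eq_count => l; rewrite /= inE.
Qed.

Lemma fiber_eq_perm g g' : fiber g =1 fiber g' -> exists w, g' = finfun (g \o w).
Proof.
move=> e; have /tuple_permP[w E] : perm_eq [tuple g' l | l < n] [tuple g l | l < n].
  by apply/allP=> y _; rewrite /= -!/(count_mem _ _); have := e y; rewrite -!count_mem_ffun /= => ->.
exists w; apply/ffunP=> l; rewrite ffunE /=.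
have := congr1 (fun s => nth (g' l) s l) E.
by rewrite -!(tnth_nth _ _ l) !tnth_mktuple.
Qed.

Lemma fiber_ex (c : Y -> nat) : (\sum_y c y = n)%N -> exists g, fiber g =1 c.
Proof.
move=> cn; pose s := flatten [seq nseq (c y) y | y <- enum Y].
have sn : size s = n.
  by rewrite size_flatten /shape -map_comp (eq_map (fun y => size_nseq _ _)) sumnE big_map big_enum.
pose t := tcast sn (in_tuple s); exists [ffun l => tnth t l] => y.
rewrite -count_mem_ffun.
have -> : [tuple [ffun l => tnth t l] l | l < n] = t.
  by apply: eq_from_tnth => l; rewrite tnth_mktuple ffunE.
rewrite val_tcast /= /s count_flatten -map_comp sumnE big_map big_enum /=.
rewrite (bigD1 y) //= count_nseq /= eqxx mul1n big1 ?addn0 // => z zy.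
by rewrite count_nseq /= (negbTE zy).
Qed.

(* The colorings with given fibers form one orbit of S_n. *)
Lemma sum_pstab (c : Y -> nat) :
  (\sum_(g : {ffun 'I_n -> Y} | [forall y, fiber g y == c y]) #|pstab g| =
   (\sum_y c y == n)%N * n`!)%N.
Proof.
case: eqP => cn; last first.
  rewrite big_pred0 // => g; apply/negP=> /'forall_eqP e; apply: cn.
  by rewrite -(sum_fiber g); apply: eq_bigr => y _.
have [g0 g0c] := fiber_ex cn; rewrite mul1n -[in RHS](card_Sn n) -sum1_card.
rewrite (partition_big (fun w : 'S_n => finfun (g0 \o w))
   (fun g : {ffun 'I_n -> Y} => [forall y, fiber g y == c y])) /=; last first.
  by move=> w _; apply/'forall_eqP=> y; rewrite fiber_perm.
apply: eq_bigr => g /'forall_eqP gc; rewrite sum1dep_card.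
have [w0 gE] : exists w, g = finfun (g0 \o w).
  by apply: fiber_eq_perm => y; rewrite g0c gc.
(* The permutations carrying [g0] to [g] form a coset of the stabilizer of [g]. *)
rewrite -[LHS](card_imset _ (mulIg w0)); apply: eq_card => w; rewrite [in RHS]inE.
apply/imsetP/eqP => [[u /pstabP ug ->]|wg].
  apply/ffunP=> l; rewrite ffunE /= permM -ug gE ffunE //=.
exists (w * w0^-1)%g; last by rewrite mulgKV.
apply/pstabP=> l; rewrite -[in RHS]wg [in LHS]gE !ffunE /= permM permKV //.
Qed.

End Fibers.

Lemma pstab_porbit n (Y : finType) (f : {ffun 'I_n -> Y}) (w : 'S_n) l m :
  w \in pstab f -> m \in porbit w l -> f m = f l.
Proof.
move=> /pstabP fw /porbitP[i ->]; elim: i => [|i IHi]; first by rewrite expg0 perm1.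
by rewrite expgSr permM fw.
Qed.

(* A coloring fixed by w has constant color on each cycle of w. *)
Lemma prod_p_sym N n (w : 'S_n) : (0 < n)%N ->
  \prod_(C in porbits w) p_sym N #|C| =
  \sum_(f : {ffun 'I_n -> 'I_N} | w \in pstab f) \prod_l 'X_(f l).
Proof.
move=> n_gt0; pose l0 := Ordinal n_gt0.
(* Expanding the product into functions on all subsets needs a default color, [ord0], off the
   cycles. With no colors both sides vanish, because a cycle exists. *)
case: N => [|N].
  rewrite (bigD1 (porbit w l0)) /=; last exact: imset_f.
  rewrite /p_sym big_ord0 mul0r big1 // => f _.
  by case: (f l0) => m; rewrite ltn0.
rewrite /p_sym (big_distr_big ord0) /=.
(* [h] reads the color of each cycle at a chosen element and [h'] spreads it back; they are inverse
   on the colorings fixed by [w]. *)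
pose h (f : {ffun 'I_n -> 'I_N.+1}) : {ffun {set 'I_n} -> 'I_N.+1} :=
  [ffun C : {set 'I_n} =>
     if C \in porbits w then f (odflt l0 [pick l in C]) else ord0].
pose h' (F : {ffun {set 'I_n} -> 'I_N.+1}) : {ffun 'I_n -> 'I_N.+1} :=
  [ffun l => F (porbit w l)].
have pickE C : C \in porbits w -> porbit w (odflt l0 [pick l in C]) = C.
  case/imsetP=> l _ ->; case: pickP => [m /= ml|/(_ l)]; last by rewrite porbit_id.
  by apply/eqP; rewrite eq_porbit_mem.
rewrite (reindex_onto h h') => [|F /pffun_onP[/subsetP sF _]]; last first.
  apply/ffunP=> C; rewrite ffunE; case: ifP => [Cw|/negbT Cw]; first by rewrite ffunE pickE.
  by apply/eqP; rewrite eq_sym; apply: contraNT Cw => nz; apply: sF.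
apply: eq_big => [f|f /andP[_ /eqP hf]].
  apply/andP/idP => [[_ /eqP hf]|fw].
    by apply/pstabP=> l; rewrite -hf !ffunE (porbit_perm w 1) .
  split; last first.
    apply/eqP/ffunP=> l; rewrite !ffunE imset_f //; apply: (pstab_porbit fw).
    by rewrite -eq_porbit_mem pickE // imset_f.
  apply/pffun_onP; split=> //; apply/subsetP=> C; rewrite inE ffunE.
  by case: ifP => //; rewrite eqxx.
rewrite [RHS](partition_big (porbit w) (mem (porbits w))) /=; last first.
  by move=> l _; apply: imset_f.
apply: eq_bigr => _ /imsetP[m _ ->]; rewrite -prodr_const.
apply: eq_big => [l|l lm]; first by rewrite eq_porbit_mem.
have /ffunP/(_ l) := hf; rewrite [h' _ _]ffunE => <-.
by rewrite (_ : porbit w l = porbit w m) //; apply/eqP; rewrite eq_porbit_mem.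
Qed.

(** * Ordered set partitions as surjections *)

Section BlockFunctions.

Variables n k : nat.

Definition block_fun (s : sized_osp n k) : {ffun 'I_n -> 'I_k} :=
  [ffun i => cast_ord (eqP (valP s)) (Ordinal (idx_lt (val s) i))].

Definition onto (f : {ffun 'I_n -> 'I_k}) : bool := [forall b, [exists i, f i == b]].

Lemma onto_osp f : onto f -> is_osp [seq [set i | f i == b] | b <- enum 'I_k].
Proof.
move/forallP=> fonto; apply/and3P; split.
- apply/mapP=> -[b _ e]; have /existsP[i /eqP ib] := fonto b.
  by have := in_set0 i; rewrite e inE ib eqxx.
- rewrite pairwise_map; have := enum_uniq 'I_k; rewrite uniq_pairwise.
  apply: sub_pairwise => b c bc; rewrite /= -setI_eq0; apply/eqP/setP=> i.
  by rewrite !inE; apply/andP=> -[/eqP-> ]; rewrite (negbTE bc).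
- apply/eqP/setP=> i; rewrite inE big_map bigcup_seq; apply/bigcupP.
  by exists (f i); rewrite ?mem_enum // inE.
Qed.

Lemma block_fun_inj : injective block_fun.
Proof.
move=> s t e; apply/val_inj/osp_eq_idx => [|i]; first by rewrite (eqP (valP s)) (eqP (valP t)).
by have /ffunP/(_ i) := e; rewrite !ffunE => /(congr1 val).
Qed.

Lemma block_fun_im : block_fun @: setT = [set f | onto f].
Proof.
apply/setP=> f; rewrite inE; apply/imsetP/idP => [[s _ ->]|fonto].
  apply/forallP=> b; apply/existsP.
  have [|i ib] := @idx_onto _ (val s) b; first by rewrite (eqP (valP s)).
  by exists i; apply/eqP/val_inj; rewrite ffunE /= ib.
have sk : size (OSP (onto_osp fonto)) == k by rewrite size_map size_enum_ord.
exists (Sub (OSP (onto_osp fonto)) sk) => //; apply/ffunP=> i; apply: val_inj; rewrite ffunE /=.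
have fk : (f i < size (OSP (onto_osp fonto)))%N by rewrite size_map size_enum_ord.
have := mem_nth_idx i fk; rewrite (nth_map (f i)) ?size_enum_ord // nth_ord_enum.
by rewrite inE eqxx => /esym/eqP.
Qed.

Lemma sum_block_fun (V : nmodType) (F : {ffun 'I_n -> 'I_k} -> V) :
  \sum_(s : sized_osp n k) F (block_fun s) = \sum_(f | onto f) F f.
Proof.
rewrite (eq_bigl (mem [set f | onto f])) => [|f]; last by rewrite !inE.
rewrite -block_fun_im big_imset; last by move=> s t _ _; apply: block_fun_inj.
by apply: eq_bigl => s; rewrite inE.
Qed.

Lemma sized_osp_fix s w : (sized_osp_act n k s w == s) = (w \in pstab (block_fun s)).
Proof.
apply/eqP/pstabP => [e l|fw].
  apply: val_inj; rewrite !ffunE /=.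
  by have := congr1 (fun u : sized_osp n k => idx (val u) (w l)) e; rewrite /= idx_act permK.
apply/val_inj/osp_eq_idx => [|i]; first by rewrite /= size_map.
have := fw (w^-1%g i); rewrite !ffunE permKV => /(congr1 val) /= ->.
by rewrite idx_act.
Qed.

Lemma trace_osp_module b w : \tr (osp_module n b k w) =
  \sum_(s : sized_osp n k) (if w \in pstab (block_fun s) then sgn_pow b w else 0).
Proof.
rewrite /= mxtraceZ /mxtrace (reindex (@enum_rank (sized_osp n k))) /=; last first.
  by apply: onW_bij; apply: enum_rank_bij.
rewrite mulr_sumr; apply: eq_bigr => s _; rewrite mxE enum_rankK mxE eqxx /=.
rewrite (inj_eq enum_rank_inj) eq_sym sized_osp_fix.
by case: ifP; rewrite ?mulr1 ?mulr0.
Qed.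

End BlockFunctions.

(** * Characteristics as sums over matrices of fiber sizes *)

Section OspModuleCharacteristic.

Variables (N n k : nat) (b : bool).
Hypothesis n_gt0 : (0 < n)%N.

Local Notation coloring := {ffun 'I_n -> 'I_k * 'I_N}.

Definition fst_coloring (g : coloring) : {ffun 'I_n -> 'I_k} := [ffun l => (g l).1].
Definition snd_coloring (g : coloring) : {ffun 'I_n -> 'I_N} := [ffun l => (g l).2].

(** A surjection and a coloring by variables that are both fixed by [w] amount to one coloring by
    pairs fixed by [w]; exchanging the sums leaves a stabilizer sum for each. *)
Lemma ch_colorings : ch N (osp_module n b k) = (n`!%:R)^-1 *:
  \sum_(g : coloring | onto (fst_coloring g))
    (\sum_(w in pstab g) sgn_pow b w) *: \prod_l 'X_((g l).2).
Proof.
rewrite /ch; congr (_ *: _).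
transitivity (\sum_(w : 'S_n) \sum_(g : coloring | onto (fst_coloring g) && (w \in pstab g))
   sgn_pow b w *: \prod_l ('X_((g l).2) : {mpoly rat[N]})); last first.
  rewrite (exchange_big_dep (fun g => onto (fst_coloring g))) /=; last by move=> w g _ /andP[].
  apply: eq_bigr => g gonto; rewrite scaler_suml; apply: eq_bigl => w.
  by rewrite gonto.
apply: eq_bigr => w _; rewrite trace_osp_module prod_p_sym //.
rewrite (sum_block_fun (fun f => if w \in pstab f then sgn_pow b w else 0)).
rewrite -big_mkcondr scaler_suml /=.
under eq_bigr do rewrite scaler_sumr.
rewrite pair_big_dep /=.
rewrite (reindex (fun g : coloring => (fst_coloring g, snd_coloring g))) /=; last first.
  exists (fun p : {ffun 'I_n -> 'I_k} * {ffun 'I_n -> 'I_N} => [ffun l => (p.1 l, p.2 l)]) => [g|p] _.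
    by apply/ffunP=> l; rewrite !ffunE -surjective_pairing.
  by rewrite [RHS]surjective_pairing; congr (_, _); apply/ffunP=> l; rewrite !ffunE.
apply: eq_big => [g|g _]; last first.
  by congr (_ *: _); apply: eq_bigr => l _; rewrite ffunE.
rewrite -andbA; congr (_ && _); apply/andP/pstabP.
  move=> [/pstabP h1 /pstabP h2] l; rewrite [LHS]surjective_pairing [RHS]surjective_pairing.
  by have := h1 l; have := h2 l; rewrite !ffunE => -> ->.
by move=> gw; split; apply/pstabP=> l; rewrite !ffunE gw.
Qed.

Local Notation counts := {ffun 'I_k -> {ffun 'I_N -> 'I_n.+1}}.

Definition fiber_counts (g : coloring) : counts :=
  [ffun r => [ffun j => inord (fiber g (r, j))]].

Lemma fiber_countsE (g : coloring) r j : fiber_counts g r j = fiber g (r, j) :> nat.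
Proof.
rewrite !ffunE inordK // ltnS -[X in (_ <= X)%N]card_ord; exact: max_card.
Qed.

Lemma fiber_counts_eq (g : coloring) (D : counts) :
  (fiber_counts g == D) = [forall y, fiber g y == D y.1 y.2].
Proof.
apply/eqP/'forall_eqP => [<- y|e]; first by rewrite fiber_countsE -surjective_pairing.
by apply/ffunP=> r; apply/ffunP=> j; apply: val_inj; rewrite /= fiber_countsE e.
Qed.

Lemma onto_fiber_counts (g : coloring) :
  onto (fst_coloring g) = [forall r, 0 < \sum_j fiber_counts g r j]%N.
Proof.
apply: eq_forallb => r; apply/existsP/idP => [[l]|].
  rewrite ffunE => /eqP lr; rewrite (bigD1 (g l).2) //= fiber_countsE.
  rewrite addn_gt0 card_gt0; apply/orP; left; apply/set0Pn; exists l.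
  by rewrite inE -lr -surjective_pairing.
rewrite lt0n sum_nat_eq0 negb_forall => /existsP[j]; rewrite fiber_countsE /= cards_eq0.
by case/set0Pn=> l; rewrite inE => /eqP gl; exists l; rewrite ffunE gl.
Qed.

Lemma injective_fiber_counts (g : coloring) :
  injectiveb g = [forall r, [forall j, fiber_counts g r j <= 1]%N].
Proof.
apply/injectiveP/forallP => [ginj r|le1 l m glm].
  apply/forallP=> j; rewrite fiber_countsE; apply/card_le1_eqP=> l m.
  by rewrite !inE => /eqP gl /eqP gm; apply: ginj; rewrite gl gm.
have := forallP (le1 (g l).1) (g l).2; rewrite fiber_countsE -surjective_pairing.
by move=> /card_le1_eqP; apply; rewrite inE ?glm.
Qed.

Lemma coloring_monomial (g : coloring) : \prod_l ('X_((g l).2) : {mpoly rat[N]}) =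
  \prod_r \prod_j 'X_j ^+ fiber_counts g r j.
Proof.
rewrite (partition_big g predT) //= pair_big /=; apply: eq_bigr => -[r j] _ /=.
rewrite fiber_countsE /fiber -prodr_const; apply: eq_big => l; first by rewrite inE.
by move/eqP=> ->.
Qed.

Definition admissible (D : counts) : bool :=
  [forall r, 0 < \sum_j D r j]%N && (b ==> [forall r, [forall j, D r j <= 1]%N]).

(** Monomial, surjectivity and injectivity depend only on the fiber sizes, so the colorings are
    grouped by these; [sum_pstab] gives each group the weight [n!]. *)
Lemma sum_colorings :
  \sum_(g : coloring | onto (fst_coloring g))
    (\sum_(w in pstab g) sgn_pow b w) *: \prod_l 'X_((g l).2) =
  n`!%:R *: \sum_(D : counts | admissible D && (\sum_r \sum_j D r j == n)%N)
    \prod_r \prod_j 'X_j ^+ D r j :> {mpoly rat[N]}.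
Proof.
transitivity (\sum_(g : coloring | admissible (fiber_counts g))
   #|pstab g|%:R *: \prod_r \prod_j ('X_j : {mpoly rat[N]}) ^+ fiber_counts g r j).
  rewrite /admissible [RHS]big_mkcondr; apply: eq_big => g; first exact: onto_fiber_counts.
  move=> _; rewrite sum_sgn_pstab -coloring_monomial injective_fiber_counts.
  case: (b) => //=.
  by case: [forall r, [forall j, fiber_counts g r j <= 1]%N]; rewrite ?scale0r.
rewrite (partition_big fiber_counts admissible) //= scaler_sumr [RHS]big_mkcondr /=.
apply: eq_bigr => D aD; pose c y := D y.1 y.2 : nat.
transitivity ((\sum_(g : coloring | [forall y, fiber g y == c y]) #|pstab g|)%:R
    *: \prod_r \prod_j ('X_j : {mpoly rat[N]}) ^+ D r j).
  rewrite natr_sum scaler_suml; apply: eq_big => g.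
    rewrite -fiber_counts_eq; case: eqP => [->|]; rewrite ?aD ?andbF //.
  by case/andP=> _ /eqP->.
rewrite sum_pstab.
have -> : (\sum_y c y = \sum_r \sum_j D r j)%N by rewrite pair_big.
by case: eqP => _; rewrite ?mul1n ?mul0n ?scale0r.
Qed.

(** The contribution of one matrix row with sum [m]: complete homogeneous when [b] is false and
    [m <= n], elementary when [b] is true and [n > 0]. *)
Definition row_sym (m : nat) : {mpoly rat[N]} :=
  \sum_(d : {ffun 'I_N -> 'I_n.+1} |
       (\sum_j d j == m)%N && (b ==> [forall j, d j <= 1]%N))
    \prod_j 'X_j ^+ d j.

(** After distributing the product over rows, a matrix occurs for exactly one composition, that of
    its row sums. *)
Lemma sum_compositions :
  \sum_(alpha in compositions n k) \prod_(i < k) row_sym (tnth alpha i) =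
  \sum_(D : counts | admissible D && (\sum_r \sum_j D r j == n)%N)
    \prod_r \prod_j 'X_j ^+ D r j.
Proof.
under eq_bigr => alpha _ do rewrite /row_sym bigA_distr_big_dep.
rewrite (exchange_big_dep predT) //= [RHS]big_mkcond; apply: eq_bigr => D _.
have famE (alpha : k.-tuple 'I_n.+1) : D \in family (fun i : 'I_k => [pred d : {ffun 'I_N -> 'I_n.+1} |
     (\sum_j d j == tnth alpha i)%N && (b ==> [forall j, d j <= 1]%N)]) =
   [forall i, (\sum_j D i j == tnth alpha i)%N] &&
     (b ==> [forall r, [forall j, D r j <= 1]%N]).
  apply/familyP/andP => [h|[/forallP h1 h2] i].
    split; first by apply/forallP=> i; have := h i; rewrite inE => /andP[].
    apply/implyP=> bT; apply/forallP=> i; have := h i; rewrite inE => /andP[_ /implyP]; exact.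
  rewrite inE h1 /=; apply/implyP=> bT; exact: (forallP (implyP h2 bT)).
case: ifP => [/andP[/andP[/forallP Dpos D1] Dn]|nD].
  have rn r : (\sum_j D r j < n.+1)%N.
    by rewrite ltnS -[X in (_ <= X)%N](eqP Dn) [X in (_ <= X)%N](bigD1 r) //= leq_addr.
  pose alpha := [tuple inord (\sum_j D r j) : 'I_n.+1 | r < k].
  have alphaE r : tnth alpha r = (\sum_j D r j)%N :> nat by rewrite tnth_mktuple inordK.
  rewrite (big_pred1 alpha) // => beta /=; rewrite famE D1 andbT.
  apply/andP/eqP => [[_ /forallP e]|->].
    by apply: eq_from_tnth => r; apply: val_inj; rewrite /= alphaE (eqP (e r)).
  split; last by apply/forallP=> r; rewrite alphaE.
  rewrite inE; apply/andP; split; first by apply/forallP=> r; rewrite alphaE.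
  by rewrite -[X in _ == X](eqP Dn); apply/eqP; apply: eq_bigr => r _; rewrite alphaE.
rewrite big_pred0 // => alpha; rewrite famE; apply/negP.
rewrite inE => /andP[/andP[/forallP apos /eqP an] /andP[/forallP e D1]].
move: nD; rewrite /admissible D1 andbT => /negP; apply; apply/andP; split.
  by apply/forallP=> r; rewrite (eqP (e r)).
by rewrite -[X in _ == X]an; apply/eqP; apply: eq_bigr => r _; rewrite (eqP (e r)).
Qed.

Lemma ch_row_sym : ch N (osp_module n b k) =
  \sum_(alpha in compositions n k) \prod_(i < k) row_sym (tnth alpha i).
Proof.
rewrite ch_colorings sum_colorings sum_compositions scalerA mulVf ?scale1r //.
by rewrite Num.Theory.pnatr_eq0 -lt0n fact_gt0.
Qed.

End OspModuleCharacteristic.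

(** * Rows as complete and elementary symmetric functions *)

Lemma row_sym_h N n m : (m <= n)%N -> row_sym N n false m = h_sym N m.
Proof.
move=> mn; pose phi (x : 'X_{1..N < m.+1}) : {ffun 'I_N -> 'I_n.+1} := [ffun j => inord (x j)].
have phiE (x : 'X_{1..N < m.+1}) j : phi x j = x j :> nat.
  (* Exponents are at most [m <= n], so the bound on matrix entries loses no monomial. *)
  rewrite ffunE inordK //; apply: leq_trans (_ : m.+1 <= n.+1)%N => //.
  by apply: leq_ltn_trans (bmdeg x); rewrite mdegE (bigD1 j) //= leq_addr.
have phi_inj : injective phi.
  move=> x y e; apply/val_inj/mnmP=> j.
  by have := phiE x j; rewrite e phiE.
have phi_im : [set phi x | x in [set x : 'X_{1..N < m.+1} | mdeg x == m]] =
    [set d : {ffun 'I_N -> 'I_n.+1} | \sum_j d j == m]%N.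
  apply/setP=> d; rewrite inE; apply/imsetP/idP => [[x + ->]|dm].
    by rewrite inE mdegE => /eqP xm; rewrite -[X in _ == X]xm; apply/eqP/eq_bigr => j _; rewrite phiE.
  have xP : (mdeg [multinom (d j : nat) | j < N] < m.+1)%N.
    by rewrite mdegE (eq_bigr (fun j => d j : nat)) ?(eqP dm) // => j _; rewrite mnmE.
  exists (BMultinom xP); last by apply/ffunP=> j; apply: val_inj; rewrite /= phiE /= mnmE.
  by rewrite inE mdegE (eq_bigr (fun j => d j : nat)) // => j _; rewrite /= mnmE.
rewrite /row_sym (eq_bigl (mem [set d : {ffun 'I_N -> 'I_n.+1} | \sum_j d j == m]%N)); last first.
  by move=> d; rewrite andbT !inE.
rewrite -phi_im big_imset; last by move=> x y _ _; apply: phi_inj.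
apply: eq_big => x; first by rewrite inE.
by move=> _; rewrite mpolyXE_id; apply: eq_bigr => j _; rewrite phiE.
Qed.

Lemma row_sym_e N n m : (0 < n)%N -> row_sym N n true m = e_sym N m.
Proof.
move=> n_gt0; pose phi (h : {set 'I_N}) : {ffun 'I_N -> 'I_n.+1} := [ffun j => inord (j \in h)].
have phiE h j : phi h j = (j \in h) :> nat.
  by rewrite ffunE inordK //; case: (j \in h).
have phi_sum h : (\sum_j phi h j = #|h|)%N.
  by rewrite -sum1_card [RHS]big_mkcond; apply: eq_bigr => j _; rewrite phiE; case: ifP.
have phi_inj : injective phi.
  move=> h h' e; apply/setP=> j; apply/(can_inj oddb).
  by have := phiE h j; rewrite e phiE => ->.
have phi_im : [set phi h | h in [set h : {set 'I_N} | #|h| == m]] =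
    [set d : {ffun 'I_N -> 'I_n.+1} | (\sum_j d j == m) && [forall j, d j <= 1]]%N.
  apply/setP=> d; rewrite inE; apply/imsetP/andP => [[h + ->]|[dm /forallP d1]].
    rewrite inE phi_sum => ->; split=> //; apply/forallP=> j; rewrite phiE leq_b1 //.
  have dE : d = phi [set j | d j == 1 :> nat]%N.
    apply/ffunP=> j; apply: val_inj; rewrite /= phiE inE.
    by have := d1 j; case: (nat_of_ord (d j)) => [|[]].
  by exists [set j | d j == 1 :> nat]%N; rewrite // inE -phi_sum -dE.
rewrite /row_sym (eq_bigl (mem [set d : {ffun 'I_N -> 'I_n.+1} |
   (\sum_j d j == m) && [forall j, d j <= 1]]%N)); last by move=> d; rewrite !inE.
rewrite -phi_im big_imset; last by move=> x y _ _; apply: phi_inj.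
apply: eq_big => h; first by rewrite inE.
move=> _; rewrite [RHS]big_mkcond; apply: eq_bigr => j _; rewrite phiE.
by case: ifP => _; rewrite ?expr1 ?expr0.
Qed.

Lemma ch_osp_module N n b k : (0 < n)%N -> ch N (osp_module n b k) =
  \sum_(alpha in compositions n k) (if b then ecomp N alpha else hcomp N alpha).
Proof.
move=> n_gt0; rewrite ch_row_sym //; apply: eq_bigr => alpha _.
case: b; apply: eq_bigr => i _; first exact: row_sym_e.
by apply: row_sym_h; rewrite -ltnS.
Qed.

Lemma sum_compositions1 n (V : nmodType) (F : nat -> V) : (0 < n)%N ->
  \sum_(alpha in compositions n 1) F (tnth alpha ord0) = F n.
Proof.
move=> n_gt0; pose alpha0 : 1.-tuple 'I_n.+1 := [tuple ord_max].
rewrite (big_pred1 alpha0) // => alpha; rewrite inE /= big_ord1.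
apply/andP/eqP => [[_ /eqP e]|->]; last first.
  by split; [apply/forallP=> i; rewrite (ord1 i) | rewrite eqxx].
by apply: eq_from_tnth => i; rewrite (ord1 i); apply: val_inj; rewrite /= e.
Qed.

(** * Transfer along isomorphisms and conclusion *)

Lemma ch_rsim N n m1 m2 (V : mx_representation rat [set: 'S_n] m1)
    (W : mx_representation rat [set: 'S_n] m2) : mx_rsim V W -> ch N V = ch N W.
Proof.
move=> VW; congr (_ *: _); apply: eq_bigr => w _.
by rewrite (mxtrace_rsim VW) ?inE.
Qed.

Lemma is_perm_osp_module n k m (V : mx_representation rat [set: 'S_n] m) :
  mx_rsim (osp_module n false k) V -> is_perm_module V.
Proof.
move=> sV; exists _, (sized_osp_act n k); apply: mx_rsim_trans (mx_rsim_sym sV) _.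
exists 1%:M => // [|a _]; first by rewrite row_free_unit unitmx1.
by rewrite mulmx1 mul1mx /= scale1r.
Qed.

Theorem mainTheorem5 (n : nat) (hn : (1 <= n)%N) :
  graded_of_rank (Omega n) n
  /\ (* (a) *)
  [/\ forall k N : nat, (k <= n - 1)%N ->
        ch N (dualWH_Omega n k) = \sum_(alpha in compositions n k.+1) hcomp N alpha,
      forall N : nat, ch N (dualWH_Omega n n) = e_sym N n
    & forall k : nat, (k <= n - 1)%N -> is_perm_module (dualWH_Omega n k)]
  /\ (* (b) *)
  ((forall k N : nat, (k <= n - 1)%N ->
     ch N (WH_Omega n (n - k)) = \sum_(alpha in compositions n k.+1) ecomp N alpha)
   /\ forall N : nat, ch N (WH_Omega n 0) = h_sym N n)
  /\ (* (c) *)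
  (forall k : nat, (k <= n)%N ->
     mx_rsim (WH_Omega n (n - k)) (prod_repr (sgn_module n) (dualWH_Omega n k))).
Proof.
have lt_n k : (k <= n - 1)%N -> (k < n)%N by lia.
split; first exact: omega_graded.
split; [split | split; [split |]].
- move=> k N /lt_n kn; rewrite -(ch_rsim N (dualWH_osp_module hn kn)).
  exact: ch_osp_module.
- move=> N; rewrite -(ch_rsim N (dualWH_top_osp_module hn)) ch_osp_module //.
  rewrite -(sum_compositions1 (e_sym N) hn).
  by apply: eq_bigr => alpha _; rewrite /ecomp big_ord1.
- by move=> k /lt_n kn; apply: is_perm_osp_module (dualWH_osp_module hn kn).
- move=> k N /lt_n kn; rewrite -(ch_rsim N (WH_osp_module hn kn)).
  exact: ch_osp_module.
- move=> N; rewrite -(ch_rsim N (WH0_osp_module hn)) ch_osp_module //.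
  rewrite -(sum_compositions1 (h_sym N) hn).
  by apply: eq_bigr => alpha _; rewrite /hcomp big_ord1.
move=> k; rewrite leq_eqVlt => /predU1P[->|kn].
  (* For [k = n] both modules come from the one-block partition: $WH_0$ untwisted and $WH^*_n$
     twisted. *)
  rewrite subnn; apply: mx_rsim_trans (mx_rsim_sym (WH0_osp_module hn)) _.
  exact/mx_rsim_sym/(sgn_osp_module (mx_rsim_sym (dualWH_top_osp_module hn))).
apply: mx_rsim_trans (mx_rsim_sym (WH_osp_module hn kn)) _.
exact/mx_rsim_sym/(sgn_osp_module (mx_rsim_sym (dualWH_osp_module hn kn))).
Qed.
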